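(* Let $n=2$, so $\mathcal P^+=\mathbb Z_{\ge0}^2$, and let $\mathfrak g$ be a simple complex Lie algebra of type $A_2$ or $C_2$. Let $\lambda\in\mathcal P^+$ and $\boldsymbol\lambda=(\lambda_1,\lambda_2)$, $\boldsymbol\mu=(\mu_1,\mu_2)\in\mathcal P^+(\lambda,2)$ with $\boldsymbol\lambda\trianglelefteq\boldsymbol\mu$. Then $$\dim V(\iota(\lambda_1))\otimes V(\iota(\lambda_2))\le\dim V(\iota(\mu_1))\otimes V(\iota(\mu_2)).$$
   Context: $\mathcal P^+=\mathbb Z_{\ge0}^2$ with standard basis $\omega_1,\omega_2$ and coordinate functionals $\omega_1^*,\omega_2^*$. $\mathcal P^+(\lambda,2)$ is the set of pairs in $\mathcal P^+$ summing to $\lambda$. For $1\le i\le j\le 2$ and $\ell\in\{1,2\}$, $r_{(i,j),\ell}(\boldsymbol\lambda)=\min\{\sum_{t=i}^j\omega_t^*(\lambda_{n_1}+\dots+\lambda_{n_\ell}):1\le n_1<\dots<n_\ell\le2\}$, and $\boldsymbol\lambda\trianglelefteq\boldsymbol\mu$ iff $r_{(i,j),\ell}(\boldsymbol\lambda)\le r_{(i,j),\ell}(\boldsymbol\mu)$ for all $i\le j,\ell$. The map $\iota$ sends $a\omega_1+b\omega_2$ to $a\varpi_1+b\varpi_2$, where $\varpi_1,\varpi_2$ are the fundamental weights of $\mathfrak g$ (Bourbaki labelling); $V(\nu)$ is the simple finite-dimensional $\mathfrak g$-module of highest weight $\nu$. *)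

(* Defs.v *)
From HB Require Import structures.
From mathcomp Require Import all_boot all_order all_algebra.
From mathcomp Require Export reals complex.

Set Implicit Arguments.
Unset Strict Implicit.
Unset Printing Implicit Defensive.

Import GRing.Theory.
Local Open Scope ring_scope.

(* ** Finite-dimensional Lie algebras and their finite-dimensional modules *)

HB.mixin Record Vector_isLieAlgebra (F : fieldType) g of Vector F g := {
  lie : g -> g -> g;
  lie_linearr : forall x, linear (lie x);
  lie_linearl : forall y, linear (lie^~ y);
  lie_alternating : forall x, lie x x = 0;
  lie_jacobi : forall x y z,
    lie x (lie y z) + lie y (lie z x) + lie z (lie x y) = 0
}.

#[short(type="lieAlgType")]
HB.structure Definition LieAlgebra (F : fieldType) :=
  { g of Vector_isLieAlgebra F g & Vector F g }.

HB.mixin Record Vector_isLieModule (F : fieldType) (g : lieAlgType F) V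
    of Vector F V := {
  lie_act : g -> V -> V;
  lie_act_linearr : forall x, linear (lie_act x);
  lie_act_linearl : forall v, linear (lie_act^~ v);
  lie_act_lie : forall x y v,
    lie_act (lie x y) v = lie_act x (lie_act y v) - lie_act y (lie_act x v)
}.

#[short(type="lieModType")]
HB.structure Definition LieModule (F : fieldType) (g : lieAlgType F) :=
  { V of Vector_isLieModule F g V & Vector F V }.

Section LieTheory.

Variables (F : fieldType) (g : lieAlgType F).

Definition lie_ideal (I : {vspace g}) : Prop :=
  forall x y : g, y \in I -> lie x y \in I.

Definition lie_subalgebra (S : {vspace g}) : Prop :=
  forall x y : g, x \in S -> y \in S -> lie x y \in S.

Definition simple_lie_algebra : Prop :=
  (exists x y : g, lie x y != 0) /\
  (forall I : {vspace g}, lie_ideal I -> I = 0%VS \/ I = fullv).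

Definition lie_submodule (V : lieModType g) (U : {vspace V}) : Prop :=
  forall (x : g) (v : V), v \in U -> lie_act x v \in U.

Definition simple_lie_module (V : lieModType g) : Prop :=
  (exists v : V, v != 0) /\
  (forall U : {vspace V}, lie_submodule U -> U = 0%VS \/ U = fullv).

(* Chevalley generators with Cartan matrix A i j = alpha_j (h_i).  By Serre's
   theorem, a simple g over the complex numbers has such generators exactly
   when its root system has Cartan matrix A; span {h_0, h_1} is then a Cartan
   subalgebra, with simple roots alpha_j and simple coroots h_i. *)
Record chevalley_generators (A : 'M[int]_2) (e h f : 'I_2 -> g) : Prop := {
  chevalley_hh : forall i j, lie (h i) (h j) = 0;
  chevalley_he : forall i j, lie (h i) (e j) = (A i j)%:~R *: e j;
  chevalley_hf : forall i j, lie (h i) (f j) = - ((A i j)%:~R *: f j);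
  chevalley_ef : forall i j, lie (e i) (f j) = if i == j then h i else 0;
  chevalley_serre_e : forall i j, i != j ->
    iter `|1 - A i j|%N (lie (e i)) (e j) = 0;
  chevalley_serre_f : forall i j, i != j ->
    iter `|1 - A i j|%N (lie (f i)) (f j) = 0;
  chevalley_gen : forall S : {vspace g}, lie_subalgebra S ->
    (forall i, [/\ e i \in S, h i \in S & f i \in S]) -> S = fullv
}.

(* A weight nu is encoded by its values nu 0 i = nu (h_i) on the simple
   coroots. *)
Definition highest_weight_vector (e h : 'I_2 -> g) (nu : 'rV[F]_2)
    (V : lieModType g) (v : V) : Prop :=
  [/\ v != 0, forall i, lie_act (e i) v = 0
    & forall i, lie_act (h i) v = nu 0 i *: v].

(* V is a model of V(nu). *)
Definition is_simple_highest_weight (e h : 'I_2 -> g) (nu : 'rV[F]_2)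
    (V : lieModType g) : Prop :=
  simple_lie_module V /\ exists v : V, highest_weight_vector e h nu v.

End LieTheory.

Variant rank2_type := A2 | C2.

(* In Bourbaki's labelling of C2, alpha_1 (index 0) is short and alpha_2
   (index 1) is long, so alpha_2 (h_1) = -2 and alpha_1 (h_2) = -1. *)
Definition cartan_matrix (X : rank2_type) : 'M[int]_2 :=
  \matrix_(i, j)
    if i == j then 2
    else if X is C2 then (if i == 0 then -2 else -1)
    else -1.

Definition fundamental_weight (F : fieldType) (i : 'I_2) : 'rV[F]_2 :=
  \row_j (i == j)%:R.

(* ** The poset P^+(lambda, 2) *)

(* The coordinate functional omega_i^* is fun lambda => lambda 0 i. *)
Definition Pplus := 'rV[nat]_2.

Definition iota_weight (F : fieldType) (lambda : Pplus) : 'rV[F]_2 :=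
  \sum_(i < 2) (lambda 0 i)%:R *: fundamental_weight F i.

Definition in_Pplus2 (lambda : Pplus) (lam : 'I_2 -> Pplus) : Prop :=
  lam 0 + lam 1 = lambda.

Definition interval_sum (i j : 'I_2) (nu : Pplus) : nat :=
  (\sum_(t < 2 | (i <= t <= j)%N) nu 0%R t)%N.

(* The strictly increasing sequences n_1 < ... < n_l are the subsets S of
   cardinality l.  The initial value of the minimum is the sum over all
   indices: an upper bound of all its terms, hence harmless when l <= 2. *)
Definition rmin (i j : 'I_2) (l : nat) (lam : 'I_2 -> Pplus) : nat :=
  \big[minn/interval_sum i j (\sum_(s < 2) lam s)]_(S : {set 'I_2} | #|S| == l)
    interval_sum i j (\sum_(s in S) lam s).

Definition trianglelefteq (lam mu : 'I_2 -> Pplus) : Prop :=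
  forall (i j : 'I_2) (l : nat), (i <= j)%N -> (1 <= l <= 2)%N ->
    (rmin i j l lam <= rmin i j l mu)%N.

(* ** Tensor products of finite-dimensional vector spaces *)

Section Tensor.

Variable F : fieldType.

(* V (x) W in the coordinates of the library's bases of V and W. *)
Definition tensor (V W : vectType F) : vectType F :=
  'M[F]_(\dim {:V}, \dim {:W}).

Definition pure_tensor (V W : vectType F) (v : V) (w : W) : tensor V W :=
  \matrix_(i, j) (coord (vbasis {:V}) i v * coord (vbasis {:W}) j w).

Lemma pure_tensor_linearr (V W : vectType F) (v : V) :
  linear (@pure_tensor V W v).
Proof.
by move=> a w w'; apply/matrixP=> i j; rewrite !mxE linearP mulrDr mulrCA.
Qed.

Lemma pure_tensor_linearl (V W : vectType F) (w : W) :
  linear ((@pure_tensor V W)^~ w).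
Proof.
by move=> a v v'; apply/matrixP=> i j; rewrite !mxE linearP mulrDl mulrA.
Qed.

Lemma tensor_universal (V W : vectType F) (U : lmodType F) (b : V -> W -> U) :
  (forall v, linear (b v)) -> (forall w, linear (b^~ w)) ->
  exists phi : {linear tensor V W -> U},
    (forall v w, phi (pure_tensor v w) = b v w) /\
    (forall psi : {linear tensor V W -> U},
       (forall v w, psi (pure_tensor v w) = b v w) -> psi =1 phi).
Proof.
move=> br bl.
pose blM w : {linear V -> U} :=
  HB.pack (b^~ w) (GRing.isLinear.Build _ _ _ _ (b^~ w) (bl w)).
pose brM v : {linear W -> U} :=
  HB.pack (b v) (GRing.isLinear.Build _ _ _ _ (b v) (br v)).
pose x i : V := (vbasis {:V})`_i.
pose y j : W := (vbasis {:W})`_j.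
pose p (M : tensor V W) : U :=
  \sum_i \sum_j (M : 'M_(_, _)) i j *: b (x i) (y j).
have plin : linear p.
  move=> a M N; rewrite /p scaler_sumr -big_split /=; apply: eq_bigr => i _.
  rewrite scaler_sumr -big_split /=; apply: eq_bigr => j _.
  by rewrite !mxE scalerDl scalerA.
pose phi : {linear tensor V W -> U} :=
  HB.pack p (GRing.isLinear.Build _ _ _ _ p plin).
exists phi; split=> [v w|psi psiE M].
  rewrite /= /p [in RHS](coord_vbasis (memvf v)) -[b _ w]/(blM w _) linear_sum.
  apply: eq_bigr => i _; rewrite linearZ /=.
  rewrite [in RHS](coord_vbasis (memvf w)) -[b _`_i _]/(brM (x i) _) linear_sum.
  rewrite scaler_sumr; apply: eq_bigr => j _.
  by rewrite linearZ /= scalerA /pure_tensor mxE.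
rewrite [in LHS](matrix_sum_delta M) /= /p linear_sum.
apply: eq_bigr => i _; rewrite linear_sum; apply: eq_bigr => j _.
rewrite linearZ /= -psiE; congr (_ *: psi _).
apply/matrixP=> i' j'; rewrite !mxE.
rewrite !coord_free ?(basis_free (vbasisP _)) // -natrM mulnb.
by rewrite eq_sym [j == _]eq_sym.
Qed.

End Tensor.

(* Main.v *)
(* By simplicity, V(nu) is spanned by the vectors f_{i1} ... f_{im} v, so it has
   a basis of weight vectors, of weights nu - i alpha_1 - j alpha_2 with i, j
   natural numbers; let X(x, y) be the polynomial sum of dim V_{i,j} x^i y^j over
   these weights.  For a positive root alpha, with x^alpha the corresponding
   monomial, cyclicity of the trace gives (1 - x^alpha) T_alpha = D_alpha X, where
   T_alpha is the graded trace of e_alpha f_alpha, and the scalar action of the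
   Casimir element expresses the Laplacian of X through the T_alpha.  Together
   these say that N = X * prod_alpha (1 - x^alpha) is an eigenvector of the
   Laplacian: N is supported on the points of the circle
   |nu + rho - i alpha_1 - j alpha_2| = |nu + rho|.  A line parallel to a simple
   root alpha meets this circle in at most two points, exchanged by the simple
   reflection, and N is divisible by 1 - x^alpha, so the coefficients of N are
   antisymmetric under the Weyl group: N is the alternating sum over the orbit of
   nu + rho.  Setting x = y = t, dividing by a power of 1 - t and putting t = 1
   gives Weyl's dimension formula.

   With p_i = omega_1^*(lambda_i) + 1 and q_i = omega_2^*(lambda_i) + 1, put
   P = p_1 p_2, Q = q_1 q_2 and S = (p_1 + q_1) (p_2 + q_2), which increase along
   the order.  The product of the dimensions is P Q S / 4 in type A2 and
   P Q S (2 S + 2 Q - P) / 36 in type C2; the latter is still increasing in P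
   because P <= S. *)
From HB Require Import structures.
Require Import Defs.
From mathcomp Require Import all_boot all_order all_algebra.
From mathcomp Require Import reals complex.
From mathcomp Require Import boolp zify ring.

Set Implicit Arguments.
Unset Strict Implicit.
Unset Printing Implicit Defensive.

Import Order.TTheory GRing.Theory Num.Theory.
Local Open Scope ring_scope.

(** For a fixed sum s, the product m (s - m) increases with m up to s / 2, and the smaller factor is
    at most s / 2. *)
Lemma mul_le_of_minn_le (p1 p2 q1 q2 : nat) :
  (p1 + p2 = q1 + q2)%N -> (minn p1 p2 <= minn q1 q2)%N ->
  (p1 * p2 <= q1 * q2)%N.
Proof. move=> ? ?; case: (leqP p1 p2) => ?; case: (leqP q1 q2) => ?; nia. Qed.

(** * Laplacian identities *)

Section Derivations.
Variable K : comNzRingType.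

Definition derivation (d : K -> K) : Prop :=
  {morph d : p q / p - q} /\ forall p q, d (p * q) = d p * q + p * d q.

Lemma derivation0 d : derivation d -> d 0 = 0.
Proof. by case=> dB _; rewrite -[0 in LHS](subrr 0) dB subrr. Qed.
Lemma derivationD d : derivation d -> {morph d : p q / p + q}.
Proof.
by move=> dP p q; rewrite -{1}[q]opprK -[- q]sub0r !dP.1 derivation0 // sub0r opprK.
Qed.
Lemma derivation1 d : derivation d -> d 1 = 0.
Proof.
move=> [_ dM]; apply: (@addrI _ (d 1)).
by rewrite addr0 -{3}[1]mulr1 dM mulr1 mul1r.
Qed.
Definition derivationE d (dP : derivation d) :=
  (derivation0 dP, derivation1 dP, dP.1, derivationD dP, dP.2).

(* On a monomial of degree (i, j), of weight mu = nu - i alpha_1 - j alpha_2, this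
   is |mu|^2 - |nu|^2, where b_kl = (alpha_k, alpha_l) and l_k = (nu, alpha_k). *)
Definition laplacian (dx dy : K -> K) (b11 b12 b22 l1 l2 : K) (p : K) : K :=
  b11 * dx (dx p) + 2 * b12 * dx (dy p)
  + b22 * dy (dy p) - 2 * l1 * dx p - 2 * l2 * dy p.

(* The conclusion is the Laplacian equation for N with nu replaced by
   nu + rho, as (rho, alpha_k) = b_kk / 2. *)
Lemma A2_laplacian (x y : K) (dx dy : K -> K)
    (dxP : derivation dx) (dyP : derivation dy)
    (dx_x : dx x = x) (dx_y : dx y = 0) (dy_x : dy x = 0) (dy_y : dy y = y)
    (l1 l2 X T1 T2 T3 : K) :
  (1 - x) * T1 = l1 * X - 2 * dx X + dy X ->
  (1 - y) * T2 = l2 * X + dx X - 2 * dy X ->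
  (1 - x * y) * T3 = (l1 + l2) * X - dx X - dy X ->
  laplacian dx dy 2 (-1) 2 l1 l2 X + (1 + x) * T1 + (1 + y) * T2 + (1 + x * y) * T3
    = 2 * (l1 + l2) * X ->
  let N := (1 - x) * (1 - y) * (1 - x * y) * X in
  2 * dx (dx N) - 2 * dx (dy N) + 2 * dy (dy N)
    - 2 * (l1 + 1) * dx N - 2 * (l2 + 1) * dy N = 0.
Proof.
move=> H1 H2 H3 HC N.
(* Leibniz rule. Replacing each first-order expression in [X] by (1 - x^alpha) T_alpha brings out
   the full product of the 1 - x^alpha, and [HC] remains. *)
have -> : 2 * dx (dx N) - 2 * dx (dy N) + 2 * dy (dy N)
    - 2 * (l1 + 1) * dx N - 2 * (l2 + 1) * dy N =
  (1 - x) * (1 - y) * (1 - x * y) * laplacian dx dy 2 (-1) 2 l1 l2 X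
  + (1 + x) * (1 - y) * (1 - x * y) * (l1 * X - 2 * dx X + dy X)
  + (1 - x) * (1 + y) * (1 - x * y) * (l2 * X + dx X - 2 * dy X)
  + (1 - x) * (1 - y) * (1 + x * y) * ((l1 + l2) * X - dx X - dy X)
  - (1 - x) * (1 - y) * (1 - x * y) * (2 * (l1 + l2) * X).
  rewrite /N /laplacian !(derivationE dxP, derivationE dyP, dx_x, dx_y, dy_x, dy_y);
    ring.
by rewrite -H1 -H2 -H3 -HC; ring.
Qed.

(** With (alpha_1, alpha_1) = 2 one has b_12 = -2, b_22 = 4 and (nu, alpha_2) = [2 * l2]. The
    positive roots sum to 2 rho = 4 alpha_1 + 3 alpha_2, whence (nu, 2 rho) = [4 * l1 + 6 * l2]. *)
Lemma C2_laplacian (x y : K) (dx dy : K -> K)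
    (dxP : derivation dx) (dyP : derivation dy)
    (dx_x : dx x = x) (dx_y : dx y = 0) (dy_x : dy x = 0) (dy_y : dy y = y)
    (l1 l2 X T1 T2 T3 T4 : K) :
  (1 - x) * T1 = l1 * X - 2 * dx X + 2 * dy X ->
  (1 - y) * T2 = 2 * l2 * X + 2 * dx X - 4 * dy X ->
  (1 - x * y) * T3 = (l1 + 2 * l2) * X - 2 * dy X ->
  (1 - x * x * y) * T4 = (2 * l1 + 2 * l2) * X - 2 * dx X ->
  laplacian dx dy 2 (-2) 4 l1 (2 * l2) X + (1 + x) * T1 + (1 + y) * T2
    + (1 + x * y) * T3 + (1 + x * x * y) * T4 = (4 * l1 + 6 * l2) * X ->
  let N := (1 - x) * (1 - y) * (1 - x * y) * (1 - x * x * y) * X in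
  2 * dx (dx N) - 4 * dx (dy N) + 4 * dy (dy N)
    - 2 * (l1 + 1) * dx N - 4 * (l2 + 1) * dy N = 0.
Proof.
move=> H1 H2 H3 H4 HC N.
have -> : 2 * dx (dx N) - 4 * dx (dy N) + 4 * dy (dy N)
    - 2 * (l1 + 1) * dx N - 4 * (l2 + 1) * dy N =
  (1 - x) * (1 - y) * (1 - x * y) * (1 - x * x * y)
    * laplacian dx dy 2 (-2) 4 l1 (2 * l2) X
  + (1 + x) * (1 - y) * (1 - x * y) * (1 - x * x * y)
    * (l1 * X - 2 * dx X + 2 * dy X)
  + (1 - x) * (1 + y) * (1 - x * y) * (1 - x * x * y)
    * (2 * l2 * X + 2 * dx X - 4 * dy X)
  + (1 - x) * (1 - y) * (1 + x * y) * (1 - x * x * y)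
    * ((l1 + 2 * l2) * X - 2 * dy X)
  + (1 - x) * (1 - y) * (1 - x * y) * (1 + x * x * y)
    * ((2 * l1 + 2 * l2) * X - 2 * dx X)
  - (1 - x) * (1 - y) * (1 - x * y) * (1 - x * x * y) * ((4 * l1 + 6 * l2) * X).
  rewrite /N /laplacian !(derivationE dxP, derivationE dyP, dx_x, dx_y, dy_x, dy_y);
    ring.
by rewrite -H1 -H2 -H3 -H4 -HC; ring.
Qed.
End Derivations.

(** * Euler operators on polynomials in two variables *)

Section Bivariate.
Variable F : numFieldType.
Local Notation K := {poly {poly F}}.

(** The operators x d/dx and y d/dy. The inner variable is x and the outer one y, so the coefficient
    of x^i y^j has outer index j and inner index i. *)
Definition thetax (p : K) : K := map_poly (fun q : {poly F} => 'X * q^`()) p.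
Definition thetay (p : K) : K := 'X * p^`().
Definition mon (d : nat * nat) : K := 'X%:P ^+ d.1 * 'X ^+ d.2.

Lemma coef_thetax (p : K) i j : (thetax p)`_j`_i = i%:R * p`_j`_i.
Proof.
rewrite /thetax coef_map_id0 ?linear0 ?mulr0 // coefXM coef_deriv.
by case: i => [|i] /=; rewrite ?mul0r // mulr_natl.
Qed.

Lemma coef_thetay (p : K) i j : (thetay p)`_j`_i = j%:R * p`_j`_i.
Proof.
rewrite /thetay coefXM coef_deriv.
by case: j => [|j] /=; rewrite ?coef0 ?mul0r // coefMn mulr_natl.
Qed.

Lemma bipolyP (p q : K) : (forall i j, p`_j`_i = q`_j`_i) -> p = q.
Proof. by move=> pq; apply/polyP=> j; apply/polyP=> i. Qed.

Lemma thetaxB (p q : K) : thetax (p - q) = thetax p - thetax q.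
Proof. by apply: bipolyP => i j; rewrite !(coef_thetax, coefB) mulrBr. Qed.
Lemma thetaxM (p q : K) : thetax (p * q) = thetax p * q + p * thetax q.
Proof.
apply/polyP => j; rewrite coefD !coefM -big_split /= coef_map_id0 ?linear0 ?mulr0 //.
rewrite coefM linear_sum /= mulr_sumr; apply: eq_bigr => k _.
rewrite !coef_map_id0 ?linear0 ?mulr0 // derivM; ring.
Qed.
Lemma derivation_thetax : derivation thetax.
Proof. by split; [exact: thetaxB | exact: thetaxM]. Qed.
Lemma derivation_thetay : derivation thetay.
Proof.
split=> p q; first by rewrite /thetay linearB mulrBr.
by rewrite /thetay derivM; ring.
Qed.

Lemma coef_mon d i j : (mon d)`_j`_i = ((i, j) == d)%:R.
Proof.
case: d => u v; rewrite /mon /= -polyC_exp coefCM coefXn.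
by rewrite mulr_natr coefMn coefXn xpair_eqE; case: (i == u); case: (j == v).
Qed.

Lemma thetax_mon d : thetax (mon d) = d.1%:R * mon d.
Proof.
apply: bipolyP => i j; rewrite coef_thetax !mulr_natl !coefMn coef_mon.
by case: eqP => [<-|_] /=; rewrite ?mul0rn.
Qed.
Lemma thetay_mon d : thetay (mon d) = d.2%:R * mon d.
Proof.
apply: bipolyP => i j; rewrite coef_thetay !mulr_natl !coefMn coef_mon.
by case: eqP => [<-|_] /=; rewrite ?mul0rn.
Qed.

Local Notation x := ('X%:P : K).
Local Notation y := ('X : K).
Lemma thetax_x : thetax x = x.
Proof. by have:= thetax_mon (1%N, 0%N); rewrite /mon /= mulr1 mul1r expr1. Qed.
Lemma thetax_y : thetax y = 0.
Proof. by have:= thetax_mon (0%N, 1%N); rewrite /mon /= mul1r mul0r. Qed.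
Lemma thetay_x : thetay x = 0.
Proof. by have:= thetay_mon (1%N, 0%N); rewrite /mon /= mulr1 mul0r expr1. Qed.
Lemma thetay_y : thetay y = y.
Proof. by have:= thetay_mon (0%N, 1%N); rewrite /mon /= !mul1r. Qed.

End Bivariate.

(** * Supports on the Weyl orbit *)

(* The two nonzero coefficients that the second hypothesis allows cancel in p(1). *)
Lemma reflect_coef (F : idomainType) (p : {poly F}) (s : nat) :
  p.[1] = 0 ->
  (forall i k, i != k -> p`_i != 0 -> p`_k != 0 -> (i + k = s)%N) ->
  forall i, p`_i != 0 -> (i <= s)%N /\ p`_(s - i) = - p`_i.
Proof.
move=> p1 two i pi0.
have ltsz k : p`_k != 0 -> (k < size p)%N.
  by apply: contraNT; rewrite -leqNgt => /(nth_default 0) ->.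
pose i0 := Ordinal (ltsz _ pi0).
have sum0 : p`_i + \sum_(k < size p | k != i0) p`_k = 0.
  rewrite -[RHS]p1 horner_coef [RHS](bigD1 i0) //= expr1n mulr1.
  by congr (_ + _); apply: eq_bigr => k _; rewrite expr1n mulr1.
have [k /andP[ki pk0]|none] := pickP [pred k : 'I_(size p) | (k != i0) && (p`_k != 0)];
    last first.
  have /eqP[] := pi0; rewrite -[RHS]sum0 big1 ?addr0 // => k ki.
  by apply/eqP; have /= := none k; rewrite ki => /negbFE.
have sE : (i + k = s)%N by apply: two; rewrite // eq_sym.
split; first by lia.
rewrite (_ : (s - i)%N = k); last by lia.
apply/eqP; rewrite -addr_eq0 addrC; move/eqP: sum0.
rewrite (bigD1 k) //= big1 ?addr0 // => l /andP[li lk].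
apply/eqP; apply: contraNT lk => pl0; apply/eqP/val_inj => /=.
have il : i != l by rewrite eq_sym.
by apply: (@addnI i); rewrite sE; apply: two.
Qed.

Ltac in_orbit :=
  first [apply/orP; first [left; lia | right; in_orbit] | lia].

Section Support.
Variable F : numFieldType.
Local Notation K := {poly {poly F}}.
Local Notation x := ('X%:P : K).
Local Notation y := ('X : K).

Lemma bipoly_support (N : K) (s : seq (nat * nat)) : uniq s ->
  (forall i j, N`_j`_i != 0 -> (i, j) \in s) ->
  N = \sum_(d <- s) N`_d.2`_d.1 *: (1 : {poly F}) *: mon F d.
Proof.
move=> s_uniq sP; apply: bipolyP => i j.
rewrite coef_sum coef_sum.
transitivity (\sum_(d <- s) if d == (i, j) then N`_j`_i else 0).
  case: (boolP ((i, j) \in s)) => ijs.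
    rewrite (bigD1_seq (i, j)) //= eqxx big1 ?addr0 // => d dij.
    by rewrite (negPf dij).
  rewrite big1_seq => [|d /= ds]; first by apply: contraNeq ijs; apply: sP.
  by case: eqP => // dE; rewrite -dE ds in ijs.
apply: eq_bigr => d _; rewrite coefZ mulr_algl coefZ coef_mon eq_sym.
by case: eqP => [<-|_]; rewrite ?mulr1 ?mulr0.
Qed.

Lemma horner_mon d : (mon F d).['X] = 'X^(d.1 + d.2).
Proof. by rewrite /mon !hornerE exprD. Qed.

(** Each row of a multiple of 1 - x is a multiple of 1 - x, hence vanishes at 1. *)
Lemma row_reflect (M : K) (s j : nat) :
  (forall i k, i != k -> ((1 - x) * M)`_j`_i != 0 ->
     ((1 - x) * M)`_j`_k != 0 -> (i + k = s)%N) ->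
  forall i, ((1 - x) * M)`_j`_i != 0 ->
    (i <= s)%N /\ ((1 - x) * M)`_j`_(s - i) = - ((1 - x) * M)`_j`_i.
Proof.
move=> two; apply: (reflect_coef _ two).
rewrite mulrBl mul1r coefB coefCM -{1}[M`_j]mul1r -mulrBl.
by rewrite !hornerE subrr mul0r.
Qed.

Lemma column_reflect (M : K) (s i : nat) :
  (forall j k, j != k -> ((1 - y) * M)`_j`_i != 0 ->
     ((1 - y) * M)`_k`_i != 0 -> (j + k = s)%N) ->
  forall j, ((1 - y) * M)`_j`_i != 0 ->
    (j <= s)%N /\ ((1 - y) * M)`_(s - j)`_i = - ((1 - y) * M)`_j`_i.
Proof.
set N := (1 - y) * M => two.
(* The i-th inner coefficients form a polynomial in y, still divisible by 1 - y. *)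
pose p := map_poly (coefp i) N.
have pE j : p`_j = N`_j`_i by rewrite coef_map.
move=> j; rewrite -!pE; apply: reflect_coef j => [|k l]; last first.
  by rewrite !pE; apply: two.
have -> : p = (1 - 'X) * map_poly (coefp i) M.
  apply/polyP => k; rewrite pE /N !mulrBl !mul1r !coefB !coefXM.
  by rewrite !coef_map; case: k => [|k] //=; rewrite coef0.
by rewrite !hornerE subrr mul0r.
Qed.

(* The list is the orbit of nu + rho, a weight nu + rho - i alpha_1 - j alpha_2
   being written (i, j); p and q are the values of nu + rho on the coroots. *)
Lemma A2_support (n : nat -> nat -> F) (p q : nat) : (0 < p)%N -> (0 < q)%N ->
  (forall i j, n i j != 0 -> (i * i + j * j = i * j + p * i + q * j)%N) ->
  (forall i j, n i j != 0 -> (i <= p + j)%N /\ n (p + j - i)%N j = - n i j) ->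
  (forall i j, n i j != 0 -> (j <= q + i)%N /\ n i (q + i - j)%N = - n i j) ->
  forall i j, n i j != 0 -> (i, j) \in
    [:: (0, 0); (p, 0); (0, q); (p, p + q); (p + q, q); (p + q, p + q)]%N.
Proof.
move=> p0 q0 ell r1 r2 i j; have [m] := ubnP (i + j)%N.
elim: m i j => // m IH i j ltm nij.
have [le1 n1] := r1 _ _ nij; have [le2 n2] := r2 _ _ nij; have el := ell _ _ nij.
(* Descent on i + j: a reflection that lowers the point leads into the list, which is stable under
   both reflections. *)
case: (ltnP (p + j - i) i) => [lt1|ge1].
  have := IH (p + j - i)%N j ltac:(lia); rewrite n1 oppr_eq0 => /(_ nij).
  rewrite !inE !xpair_eqE; move=> /or4P[|||/or3P[||]] /andP[/eqP ? /eqP ?];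
  by in_orbit.
case: (ltnP (q + i - j) j) => [lt2|ge2].
  have := IH i (q + i - j)%N ltac:(lia); rewrite n2 oppr_eq0 => /(_ nij).
  rewrite !inE !xpair_eqE; move=> /or4P[|||/or3P[||]] /andP[/eqP ? /eqP ?];
  by in_orbit.
(* If neither reflection lowers the point, then 2 i <= p + j and 2 j <= q + i. Multiplied by i and j
   and added, these leave p i + q j <= 0 in the circle equation, so the point is the origin. *)
have hi : (i * (2 * i) <= i * (p + j))%N by rewrite leq_mul2l; lia.
have hj : (j * (2 * j) <= j * (q + i))%N by rewrite leq_mul2l; lia.
have [/eqP] : (p * i = 0 /\ q * j = 0)%N by lia.
by rewrite !inE muln_eq0 => ? /eqP; rewrite muln_eq0 xpair_eqE; lia.
Qed.

(** The same descent, with the circle equation divided by 2; the [2 * j] in the first reflection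
    comes from alpha_2 (h_1) = -2. *)
Lemma C2_support (n : nat -> nat -> F) (p q : nat) : (0 < p)%N -> (0 < q)%N ->
  (forall i j, n i j != 0 ->
     (i * i + 2 * (j * j) = 2 * (i * j) + p * i + 2 * (q * j))%N) ->
  (forall i j, n i j != 0 ->
     (i <= p + 2 * j)%N /\ n (p + 2 * j - i)%N j = - n i j) ->
  (forall i j, n i j != 0 -> (j <= q + i)%N /\ n i (q + i - j)%N = - n i j) ->
  forall i j, n i j != 0 -> (i, j) \in
    [:: (0, 0); (p, 0); (0, q); (p, p + q); (p + 2 * q, q);
        (2 * p + 2 * q, p + q); (p + 2 * q, p + 2 * q);
        (2 * p + 2 * q, p + 2 * q)]%N.
Proof.
move=> p0 q0 ell r1 r2 i j; have [m] := ubnP (i + j)%N.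
elim: m i j => // m IH i j ltm nij.
have [le1 n1] := r1 _ _ nij; have [le2 n2] := r2 _ _ nij; have el := ell _ _ nij.
case: (ltnP (p + 2 * j - i) i) => [lt1|ge1].
  have := IH (p + 2 * j - i)%N j ltac:(lia); rewrite n1 oppr_eq0 => /(_ nij).
  rewrite !inE !xpair_eqE; move=> /or4P[|||/or4P[|||/orP[|]]] /andP[/eqP ? /eqP ?];
  by in_orbit.
case: (ltnP (q + i - j) j) => [lt2|ge2].
  have := IH i (q + i - j)%N ltac:(lia); rewrite n2 oppr_eq0 => /(_ nij).
  rewrite !inE !xpair_eqE; move=> /or4P[|||/or4P[|||/orP[|]]] /andP[/eqP ? /eqP ?];
  by in_orbit.
have hi : (i * (2 * i) <= i * (p + 2 * j))%N by rewrite leq_mul2l; lia.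
have hj : (j * (2 * j) <= j * (q + i))%N by rewrite leq_mul2l; lia.
have [/eqP] : (p * i = 0 /\ q * j = 0)%N by lia.
by rewrite !inE muln_eq0 => ? /eqP; rewrite muln_eq0 xpair_eqE; lia.
Qed.
End Support.

Lemma natr_mulIf (F : numFieldType) (m n : nat) (c : F) :
  m%:R * c = n%:R * c -> c != 0 -> m = n.
Proof. by move=> mn c0; apply/eqP; rewrite -(eqr_nat F) -(inj_eq (mulIf c0)) mn. Qed.

(** * Weyl's dimension formula from the support of N *)

Section WeylDimension.
Variable F : numFieldType.
Local Notation K := {poly {poly F}}.
Local Notation x := ('X%:P : K).
Local Notation y := ('X : K).
Local Notation dx := (@thetax F).
Local Notation dy := (@thetay F).

Definition geom (n : nat) : {poly F} := \sum_(i < n) 'X^i.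

Lemma one_subXn n : 1 - 'X^n = (1 - 'X) * geom n.
Proof. by rewrite -opprB subrX1 -mulNr opprB. Qed.

Lemma horner1_geom n : (geom n).[1] = n%:R.
Proof.
rewrite horner_sum (eq_bigr (fun=> 1)) => [|i _]; last by rewrite hornerXn expr1n.
by rewrite sumr_const card_ord.
Qed.

Lemma one_subX_neq0 : 1 - 'X != 0 :> {poly F}.
Proof. by rewrite -oppr_eq0 opprB -polyC1 polyXsubC_eq0. Qed.

(** Here [p] and [q] are the values of nu + rho on the simple coroots; [X.['X].[1]] restricts to the
    diagonal y = x and then evaluates at 1. *)
Lemma A2_dimension (X : K) (p q : nat) (p0 : (0 < p)%N) (q0 : (0 < q)%N) :
  let N := (1 - x) * (1 - y) * (1 - x * y) * X in
  X`_0`_0 = 1 ->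
  2 * dx (dx N) - 2 * dx (dy N) + 2 * dy (dy N)
    - 2 * p%:R * dx N - 2 * q%:R * dy N = 0 ->
  2 * X.['X].[1] = (p * q * (p + q))%:R.
Proof.
move=> N X00 HN.
(* The operator multiplies x^i y^j by a difference of squared lengths, which must be 0 wherever [N]
   has a coefficient. *)
have ell i j : N`_j`_i != 0 -> (i * i + j * j = i * j + p * i + q * j)%N.
  move: (congr1 (fun P : K => P`_j`_i) HN).
  rewrite -!(mulrA 2) !(mulr_natl, coefD, coefN, coefB, coefMn, coef_thetax,
    coef_thetay) !coef0.
  set c := N`_j`_i => E; apply: natr_mulIf; apply/eqP; rewrite -subr_eq0.
  by apply/eqP; rewrite -[RHS](mulr0 2^-1) -E !(natrD, natrM); field.
(* For fixed j the circle equation is quadratic in i, with roots of sum p + j. *)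
have r1 i j : N`_j`_i != 0 -> (i <= p + j)%N /\ N`_j`_(p + j - i) = - N`_j`_i.
  rewrite /N -!(mulrA (1 - x)); apply: row_reflect i => i k ik.
  rewrite !(mulrA (1 - x)) => /ell ei /ell ek; move/eqP: ik; nia.
have r2 i j : N`_j`_i != 0 -> (j <= q + i)%N /\ N`_(q + i - j)`_i = - N`_j`_i.
  rewrite /N -(mulrC (1 - y)) -!(mulrA (1 - y)); apply: column_reflect j => j k jk.
  rewrite !(mulrA (1 - y)) (mulrC (1 - y)) => /ell ej /ell ek; move/eqP: jk; nia.
have N00 : N`_0`_0 = 1.
  by rewrite /N !(coef0M, coefB, coefX, coefC, coef1) /= X00; ring.
have [|_] := r1 0 0; first by rewrite N00 oner_eq0.
rewrite addn0 subn0 N00 => Np0.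
have [|_] := r2 0 0; first by rewrite N00 oner_eq0.
rewrite addn0 subn0 N00 => N0q.
have [|_] := r2 p 0; first by rewrite Np0 oppr_eq0 oner_eq0.
rewrite subn0 Np0 opprK addnC => Nps.
have [|_] := r1 0 q; first by rewrite N0q oppr_eq0 oner_eq0.
rewrite subn0 N0q opprK => Nsq.
have [|_] := r1 p (p + q)%N; first by rewrite Nps oner_eq0.
rewrite addKn Nps => Nss.
have NE := bipoly_support _ (A2_support p0 q0 ell r1 r2).
(* On the diagonal the alternating sum factors over the positive coroots, by the denominator
   identity of the dual root system. *)
have {NE} : N.['X] = (1 - 'X^p) * (1 - 'X^q) * (1 - 'X^(p + q)).
  rewrite NE; last by rewrite /= !inE !xpair_eqE; do ?[apply/andP; split]; lia.
  rewrite !big_cons big_nil /= N00 Np0 N0q Nps Nsq Nss.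
  rewrite !(hornerD, hornerZ, horner_mon, horner0) /= !scaleNr !scale1r !addn0 !add0n
    !exprD expr0.
  by move: ('X^p) ('X^q) => u v; ring.
have -> : N.['X] = (1 - 'X^1) * (1 - 'X^1) * (1 - 'X^2) * X.['X].
  by rewrite /N !hornerE.
rewrite !one_subXn => E.
(* One factor 1 - X per positive root must cancel before evaluation at 1. *)
have /(congr1 (horner^~ 1)) :
    geom 1 * geom 1 * geom 2 * X.['X] = geom p * geom q * geom (p + q).
  apply: (mulfI (expf_neq0 3 one_subX_neq0)); rewrite [RHS](_ : _ =
    (1 - 'X) * geom p * ((1 - 'X) * geom q) * ((1 - 'X) * geom (p + q))).
    by rewrite -E; ring.
  by ring.
by rewrite !hornerM !horner1_geom => E1; rewrite !natrM -E1 -!natrM.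
Qed.

Lemma C2_dimension (X : K) (p q : nat) (p0 : (0 < p)%N) (q0 : (0 < q)%N) :
  let N := (1 - x) * (1 - y) * (1 - x * y) * (1 - x * x * y) * X in
  X`_0`_0 = 1 ->
  2 * dx (dx N) - 4 * dx (dy N) + 4 * dy (dy N)
    - 2 * p%:R * dx N - 4 * q%:R * dy N = 0 ->
  6 * X.['X].[1] = (p * q * (p + q) * (p + 2 * q))%:R.
Proof.
move=> N X00 HN.
have ell i j : N`_j`_i != 0 ->
    (i * i + 2 * (j * j) = 2 * (i * j) + p * i + 2 * (q * j))%N.
  move: (congr1 (fun P : K => P`_j`_i) HN).
  rewrite -!(mulrA 2) -!(mulrA 4).
  rewrite !(mulr_natl, coefD, coefN, coefB, coefMn, coef_thetax, coef_thetay) !coef0.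
  set c := N`_j`_i => E; apply: natr_mulIf; apply/eqP; rewrite -subr_eq0.
  by apply/eqP; rewrite -[RHS](mulr0 2^-1) -E !(natrD, natrM); field.
have r1 i j : N`_j`_i != 0 -> (i <= p + 2 * j)%N /\ N`_j`_(p + 2 * j - i) = - N`_j`_i.
  rewrite /N -!(mulrA (1 - x)); apply: row_reflect i => i k ik.
  rewrite !(mulrA (1 - x)) => /ell ei /ell ek; move/eqP: ik; nia.
have r2 i j : N`_j`_i != 0 -> (j <= q + i)%N /\ N`_(q + i - j)`_i = - N`_j`_i.
  rewrite /N -(mulrC (1 - y)) -!(mulrA (1 - y)); apply: column_reflect j => j k jk.
  rewrite !(mulrA (1 - y)) (mulrC (1 - y)) => /ell ej /ell ek; move/eqP: jk; nia.
have N00 : N`_0`_0 = 1.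
  by rewrite /N !(coef0M, coefB, coefX, coefC, coef1) /= X00; ring.
have [|_] := r1 0 0; first by rewrite N00 oner_eq0.
rewrite addn0 subn0 N00 => Np0.
have [|_] := r2 0 0; first by rewrite N00 oner_eq0.
rewrite addn0 subn0 N00 => N0q.
have [|_] := r2 p 0; first by rewrite Np0 oppr_eq0 oner_eq0.
rewrite subn0 Np0 opprK addnC => N3.
have [|_] := r1 0 q; first by rewrite N0q oppr_eq0 oner_eq0.
rewrite subn0 N0q opprK => N4.
have [|_] := r1 p (p + q)%N; first by rewrite N3 oner_eq0.
rewrite addKn N3 mulnDr => N5.
have [|_] := r2 (p + 2 * q)%N q; first by rewrite N4 oner_eq0.
rewrite addKn N4 => N6.
have [|_] := r1 (p + 2 * q)%N (p + 2 * q)%N; first by rewrite N6 oppr_eq0 oner_eq0.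
rewrite (_ : p + 2 * (p + 2 * q) - (p + 2 * q) = 2 * p + 2 * q)%N; last by lia.
rewrite N6 opprK => N7.
have NE := bipoly_support _ (C2_support p0 q0 ell r1 r2).
have {NE} : N.['X] =
    (1 - 'X^p) * (1 - 'X^q) * (1 - 'X^(p + q)) * (1 - 'X^(p + 2 * q)).
  rewrite NE; last by rewrite /= !inE !xpair_eqE; do ?[apply/andP; split]; lia.
  rewrite !big_cons big_nil /= N00 Np0 N0q N3 N4 N5 N6 N7.
  rewrite !(hornerD, hornerZ, horner_mon, horner0) /= !scaleNr !scale1r.
  rewrite !addn0 !add0n !exprD !expr0.
  by move: ('X^p) ('X^q) => u v; ring.
have -> : N.['X] = (1 - 'X^1) * (1 - 'X^1) * (1 - 'X^2) * (1 - 'X^3) * X.['X].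
  by rewrite /N !hornerE; ring.
rewrite !one_subXn => E.
have /(congr1 (horner^~ 1)) :
    geom 1 * geom 1 * geom 2 * geom 3 * X.['X] =
      geom p * geom q * geom (p + q) * geom (p + 2 * q).
  apply: (mulfI (expf_neq0 4 one_subX_neq0)); rewrite [RHS](_ : _ =
    (1 - 'X) * geom p * ((1 - 'X) * geom q) * ((1 - 'X) * geom (p + q))
      * ((1 - 'X) * geom (p + 2 * q))).
    by rewrite -E; ring.
  by ring.
by rewrite !hornerM !horner1_geom => E1; rewrite !natrM -E1 -!natrM.
Qed.
End WeylDimension.

(** * Casimir elements *)

Section Commutators.
Variables (F : numFieldType) (n : nat).
Implicit Types A B C : 'M[F]_n.

Definition brk A B : 'M[F]_n := A *m B - B *m A.

Lemma brkC A B : brk A B = - brk B A.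
Proof. by rewrite /brk opprB. Qed.
Lemma brk_mulr A B C : brk A (B *m C) = brk A B *m C + B *m brk A C.
Proof. by rewrite /brk mulmxBl mulmxBr !mulmxA addrA subrK. Qed.
Lemma brk0 A : brk A 0 = 0.
Proof. by rewrite /brk mulmx0 mul0mx subrr. Qed.
Lemma brkD A B C : brk A (B + C) = brk A B + brk A C.
Proof. by rewrite /brk mulmxDl mulmxDr opprD addrACA. Qed.
Lemma brkN A B : brk A (- B) = - brk A B.
Proof. by rewrite /brk mulmxN mulNmx opprB opprK addrC. Qed.
Lemma brkZ A c B : brk A (c *: B) = c *: brk A B.
Proof. by rewrite /brk -scalemxAl -scalemxAr scalerBr. Qed.
Lemma brkZl A c B : brk (c *: A) B = c *: brk A B.
Proof. by rewrite brkC brkZ brkC scalerN opprK. Qed.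
Lemma brkA A B C : brk A (brk B C) = brk (brk A B) C + brk B (brk A C).
Proof.
rewrite {2}/brk brkD brkN !brk_mulr /brk !(mulmxBl, mulmxBr) !mulmxA.
by apply/matrixP=> i j; rewrite !mxE; ring.
Qed.
Lemma brkAl A B C : brk (brk A B) C = brk A (brk B C) - brk B (brk A C).
Proof. by rewrite [brk A (brk B C)]brkA addrK. Qed.
Lemma brkK A B : brk A B = 0 -> A *m B = B *m A.
Proof. by move/subr0_eq. Qed.

Definition anti A B := A *m B + B *m A.

Lemma brk_anti A B C : brk A (anti B C) = anti (brk A B) C + anti B (brk A C).
Proof.
by rewrite /anti brkD !brk_mulr [X in _ + X = _]addrC addrACA.
Qed.
Lemma antiC A B : anti A B = anti B A. Proof. by rewrite /anti addrC. Qed.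
Lemma anti0 A : anti A 0 = 0. Proof. by rewrite /anti mulmx0 mul0mx addr0. Qed.
Lemma antiN A B : anti A (- B) = - anti A B.
Proof. by rewrite /anti mulmxN mulNmx opprD. Qed.
Lemma antiZ A c B : anti A (c *: B) = c *: anti A B.
Proof. by rewrite /anti -scalemxAl -scalemxAr scalerDr. Qed.

Lemma antiNl A B : anti (- A) B = - anti A B.
Proof. by rewrite antiC antiN antiC. Qed.
Lemma antiZl A c B : anti (c *: A) B = c *: anti A B.
Proof. by rewrite antiC antiZ antiC. Qed.
Lemma anti0l A : anti 0 A = 0. Proof. by rewrite antiC anti0. Qed.
Lemma brk_self A : brk A A = 0. Proof. exact: subrr. Qed.
Lemma brk_flip A B C : brk A B = C -> brk B A = - C.
Proof. by move=> <-; exact: brkC. Qed.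

Variables (E1 E2 F1 F2 H1 H2 : 'M[F]_n).
Local Notation E3 := (brk E1 E2).
Local Notation F3 := (brk F2 F1).

(* c = alpha_2(h_1), while alpha_1(h_2) = -1 in both types. *)
Record chevalley_matrices (c : F) : Prop := {
  cm_E1F1 : brk E1 F1 = H1;  cm_E1F2 : brk E1 F2 = 0;
  cm_E2F1 : brk E2 F1 = 0;   cm_E2F2 : brk E2 F2 = H2;
  cm_H1E1 : brk H1 E1 = 2 *: E1; cm_H1E2 : brk H1 E2 = c *: E2;
  cm_H2E1 : brk H2 E1 = - E1;    cm_H2E2 : brk H2 E2 = 2 *: E2;
  cm_H1F1 : brk H1 F1 = - (2 *: F1); cm_H1F2 : brk H1 F2 = - (c *: F2);
  cm_H2F1 : brk H2 F1 = F1;          cm_H2F2 : brk H2 F2 = - (2 *: F2)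
}.

Variables (c : F) (cm : chevalley_matrices c).

Lemma brk_E3F1 : brk E3 F1 = c *: E2.
Proof.
by case: cm => e11 _ e21 _ _ h12 *; rewrite brkAl e21 e11 brk0 sub0r -brkC h12.
Qed.
Lemma brk_E3F2 : brk E3 F2 = E1.
Proof.
by case: cm => _ e12 _ e22 _ _ h21 *; rewrite brkAl e12 e22 brk0 subr0 brkC h21 opprK.
Qed.
Lemma brk_E1F3 : brk E1 F3 = c *: F2.
Proof.
case: cm => e11 e12 _ _ _ _ _ _ _ h12 *.
by rewrite brkA e12 e11 brkC brk0 oppr0 add0r brkC h12 opprK.
Qed.
Lemma brk_E3F3 : brk E3 F3 = H1 - c *: H2.
Proof.
case: cm => e11 e12 e21 e22 *.
by rewrite brkA brk_E3F2 brk_E3F1 e11 brkZ [brk F2 E2]brkC e22 scalerN.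
Qed.

Lemma C2_brk_E4F1 : c = -2 -> brk (brk E1 E3) F1 = - (2 *: E3).
Proof.
move=> c2; have [e11 _ _ _ h11 h12 _ _ _ _ _ _] := cm.
rewrite brkAl brk_E3F1 e11 brkZ [brk E3 H1]brkC (brkA H1) h11 h12 brkZ c2.
rewrite brkZl; move: (brk E1 E2) => e.
by apply/matrixP=> i j; rewrite !mxE; ring.
Qed.
Lemma C2_brk_E4F2 : brk (brk E1 E3) F2 = 0.
Proof.
have [_ e12 *] := cm.
by rewrite brkAl brk_E3F2 e12 brk_self sub0r brk0 oppr0.
Qed.
Lemma C2_brk_E4F3 : c = -2 -> brk (brk E1 E3) F3 = 2 *: E1.
Proof.
move=> c2; have [_ _ _ _ h11 _ h21 _ _ _ _ _] := cm.
rewrite brkAl brk_E3F3 brk_E1F3 c2 brkZ brk_E3F2.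
rewrite brkD brkN brkZ (brk_flip h11) (brk_flip h21).
by apply/matrixP=> i j; rewrite !mxE; ring.
Qed.
Lemma C2_brk_E4F4 : c = -2 -> brk (brk E1 E3) (brk F3 F1) = 4 *: (H1 + H2).
Proof.
move=> c2; have [e11 *] := cm.
rewrite brkA C2_brk_E4F3 // C2_brk_E4F1 // brkN brkZ (brkC F3) brk_E3F3 c2.
rewrite brkZl e11.
by apply/matrixP=> i j; rewrite !mxE; ring.
Qed.
End Commutators.

(** Symmetrized products become opaque matrices, so that only a linear identity between entries
    remains. *)
Ltac anti_linear :=
  repeat match goal with |- context [anti ?A ?B] => move: (anti A B); intro end;
  apply/matrixP=> i j; rewrite !mxE; field.

Section Casimir.
Variables (F : numFieldType) (n : nat) (E1 E2 F1 F2 H1 H2 : 'M[F]_n).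
Local Notation E3 := (brk E1 E2).
Local Notation F3 := (brk F2 F1).
Local Notation E4 := (brk E1 E3).
Local Notation F4 := (brk F3 F1).

(** The Cartan part comes from the inverse Cartan matrix. The order in [brk F2 F1] makes the bracket
    of [E3] and [F3] the coroot H1 + H2. *)
Definition A2_casimir : 'M[F]_n :=
  3^-1 *: (anti H1 H1 + anti H1 H2 + anti H2 H2)
  + anti E1 F1 + anti E2 F2 + anti E3 F3.

(* The form is normalized by (alpha_1, alpha_1) = 2, and brk E4 F4 = 4 *: (H1 + H2)
   is 4 times the coroot of the long root 2 alpha_1 + alpha_2. *)
Definition C2_casimir : 'M[F]_n :=
  2^-1 *: anti H1 H1 + anti H1 H2 + anti H2 H2
  + anti E1 F1 + 2 *: anti E2 F2 + anti E3 F3 + 2^-1 *: anti E4 F4.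

(** Bracketing with [F1] or [F2] is a derivation for [anti], and the resulting terms cancel. The two
    vanishing brackets are Serre relations; commutation with [F1] and [F2] is what [wm_cyclic] asks
    for. *)
Lemma A2_casimir_central (cm : chevalley_matrices E1 E2 F1 F2 H1 H2 (-1)) :
  brk F1 F3 = 0 -> brk F2 F3 = 0 ->
  A2_casimir *m F1 = F1 *m A2_casimir /\ A2_casimir *m F2 = F2 *m A2_casimir.
Proof.
move=> s1 s2; have f13 := brkC F1 F2.
have [/brk_flip e11 /brk_flip e12 /brk_flip e21 /brk_flip e22 _ _ _ _] := cm.
move=> /brk_flip h11 /brk_flip h12 /brk_flip h21 /brk_flip h22.
have /brk_flip e31 := brk_E3F1 cm; have /brk_flip e32 := brk_E3F2 cm.
rewrite /A2_casimir; move: s1 s2 f13 e31 e32.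
move: (brk E1 E2) => e3; move f21: (brk F2 F1) => f3 s1 s2 f13 e31 e32.
split; apply/esym/brkK; rewrite !(brkD, brkZ, brk_anti).
  rewrite e11 e21 e31 h11 h21 s1 brk_self f13.
  by rewrite !(anti0l, anti0, antiNl, antiN, antiZl, antiZ) !(antiC _ F1)
    !(antiC _ f3); anti_linear.
rewrite e12 e22 e32 h12 h22 s2 brk_self f21.
by rewrite !(anti0l, anti0, antiNl, antiN, antiZl, antiZ) !(antiC _ F2)
    !(antiC _ f3); anti_linear.
Qed.

Lemma C2_casimir_central (cm : chevalley_matrices E1 E2 F1 F2 H1 H2 (-2)) :
  brk F1 F4 = 0 -> brk F2 F3 = 0 ->
  C2_casimir *m F1 = F1 *m C2_casimir /\ C2_casimir *m F2 = F2 *m C2_casimir.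
Proof.
move=> s1 s2; have f13 := brkC F1 F2.
have e41 := brk_flip (C2_brk_E4F1 cm erefl); have e42 := brk_flip (C2_brk_E4F2 cm).
(* 2 alpha_1 + 2 alpha_2 is not a root; the Jacobi identity reduces this to [s2]. *)
have f14 := brkC F1 F3; have f24 : brk F2 F4 = 0.
  by rewrite brkA s2 brkC brk0 oppr0 add0r brk_self.
have [/brk_flip e11 /brk_flip e12 /brk_flip e21 /brk_flip e22 _ _ _ _] := cm.
move=> /brk_flip h11 /brk_flip h12 /brk_flip h21 /brk_flip h22.
have /brk_flip e31 := brk_E3F1 cm; have /brk_flip e32 := brk_E3F2 cm.
rewrite /C2_casimir; move: s1 s2 f13 f14 f24 e31 e32 e41 e42.
move: (brk E1 E2) (brk E1 (brk E1 E2)) (brk (brk F2 F1) F1) => e3 e4 f4.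
move f21: (brk F2 F1) => f3 s1 s2 f13 f14 f24 e31 e32 e41 e42.
split; apply/esym/brkK; rewrite !(brkD, brkZ, brk_anti).
  rewrite e11 e21 e31 e41 h11 h21 s1 brk_self f13 f14.
  by rewrite !(anti0l, anti0, antiNl, antiN, antiZl, antiZ) !(antiC _ F1)
    !(antiC _ f3) !(antiC _ f4); anti_linear.
rewrite e12 e22 e32 e42 h12 h22 s2 brk_self f21 f24.
by rewrite !(anti0l, anti0, antiNl, antiN, antiZl, antiZ) !(antiC _ F2)
    !(antiC _ f3); anti_linear.
Qed.
End Casimir.

(** * Graded traces *)

Section GradedTrace.
Variables (F : numFieldType) (n : nat) (deg : 'I_n -> nat * nat).
Local Notation K := {poly {poly F}}.
Local Notation x := ('X%:P : K).
Local Notation y := ('X : K).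

(** With [w] constantly 1 this is the character X. The Euler operators act through [w], which
    reduces identities to one basis vector at a time. *)
Definition gen (w : 'I_n -> F) : K := \sum_k (w k)%:P%:P * mon F (deg k).
Definition gtr (M : 'M[F]_n) : K := gen (fun k => M k k).

Lemma eq_gen w w' : w =1 w' -> gen w = gen w'.
Proof. by move=> ww; apply: eq_bigr => k _; rewrite ww. Qed.
Lemma genD w w' : gen w + gen w' = gen (fun k => w k + w' k).
Proof. by rewrite /gen -big_split; apply: eq_bigr => k _; rewrite !rmorphD mulrDl. Qed.
Lemma genN w : - gen w = gen (fun k => - w k).
Proof. by rewrite /gen -sumrN; apply: eq_bigr => k _; rewrite !rmorphN mulNr. Qed.
Lemma genM m w : m%:R * gen w = gen (fun k => m%:R * w k).
Proof.
by rewrite /gen mulr_sumr; apply: eq_bigr => k _; rewrite !rmorphM !rmorph_nat mulrA.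
Qed.
Lemma genZ c w : c%:P%:P * gen w = gen (fun k => c * w k).
Proof. by rewrite /gen mulr_sumr; apply: eq_bigr => k _; rewrite !rmorphM mulrA. Qed.
Lemma thetax_gen w : thetax (gen w) = gen (fun k => (deg k).1%:R * w k).
Proof.
apply: bipolyP => i j; rewrite coef_thetax !coef_sum mulr_sumr; apply: eq_bigr => k _.
rewrite !coefCM coef_mon; case: eqP => [<-|_] /=; last by rewrite !mulr0.
by rewrite mulrA.
Qed.
Lemma thetay_gen w : thetay (gen w) = gen (fun k => (deg k).2%:R * w k).
Proof.
apply: bipolyP => i j; rewrite coef_thetay !coef_sum mulr_sumr; apply: eq_bigr => k _.
rewrite !coefCM coef_mon; case: eqP => [<-|_] /=; last by rewrite !mulr0.
by rewrite mulrA.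
Qed.
Definition genE := (thetax_gen, thetay_gen, genM, genN, genD, genZ).

Lemma gen1_horner : (gen (fun=> 1)).['X].[1] = n%:R.
Proof.
rewrite /gen !horner_sum (eq_bigr (fun=> 1)) => [|k _].
  by rewrite sumr_const card_ord.
by rewrite mul1r horner_mon hornerXn expr1n.
Qed.

(* Column l of M holds the image of the l-th basis vector, and the degree (i, j)
   stands for the weight nu - i alpha_1 - j alpha_2: M lowers degrees by d, that is,
   raises weights by d.1 alpha_1 + d.2 alpha_2. *)
Definition lowers (d : nat * nat) (M : 'M[F]_n) : Prop :=
  forall k l, M k l != 0 -> deg l = ((deg k).1 + d.1, (deg k).2 + d.2)%N.

Lemma lowersM d d' M N : lowers d M -> lowers d' N ->
  lowers (d.1 + d'.1, d.2 + d'.2)%N (M *m N).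
Proof.
move=> dM dN k l; rewrite mxE => MN.
have [j] : exists j, M k j * N j l != 0.
  apply/existsP; apply: contraNT MN => /existsPn none.
  by rewrite big1 // => j _; apply/eqP; have := none j; rewrite negbK.
rewrite mulf_eq0 negb_or => /andP[/dM Mkj /dN ->].
by rewrite Mkj /= !addnA.
Qed.

Lemma lowersB d M N : lowers d M -> lowers d N -> lowers d (M - N).
Proof.
move=> dM dN k l; rewrite !mxE; have [->|/dM //] := eqVneq (M k l) 0.
by rewrite sub0r oppr_eq0 => /dN.
Qed.

Lemma lowers_brk d d' M N : lowers d M -> lowers d' N ->
  lowers (d.1 + d'.1, d.2 + d'.2)%N (brk M N).
Proof.
move=> dM dN; apply: lowersB; first exact: lowersM.
by rewrite [X in (X, _)]addnC [X in (_, X)]addnC; exact: lowersM.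
Qed.

(** Cyclicity of the trace: a nonzero [N k l * M l k] forces the degree of k to exceed that of l by
    [d], which gives the monomial. *)
Lemma gtr_lowers d M N : lowers d M -> gtr (N *m M) = mon F d * gtr (M *m N).
Proof.
move=> dM; rewrite /gtr /gen mulr_sumr.
transitivity (\sum_k \sum_l (N k l * M l k)%:P%:P * mon F (deg k)).
  by apply: eq_bigr => k _; rewrite mxE !rmorph_sum mulr_suml.
rewrite exchange_big; apply: eq_bigr => l _ /=.
rewrite mxE !rmorph_sum mulr_suml mulr_sumr; apply: eq_bigr => k _ /=.
have [->|/dM ->] := eqVneq (M l k) 0; first by rewrite mulr0 !mul0r mulr0.
rewrite [N k l * _]mulrC /mon /= !exprD; ring.
Qed.

(** For opposite root vectors the bracket is diagonal, so the right side is a first-order expression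
    in X. *)
Lemma gtr_brk d M N : lowers d M ->
  (1 - mon F d) * gtr (M *m N) = gtr (brk M N).
Proof.
move=> dM; rewrite mulrBl mul1r -(gtr_lowers N dM) /brk /gtr genN genD.
by apply: eq_gen => k; rewrite !mxE.
Qed.

Lemma gtr_anti d M N : lowers d M ->
  (1 + mon F d) * gtr (M *m N) = gtr (anti M N).
Proof.
move=> dM; rewrite mulrDl mul1r -(gtr_lowers N dM) /anti /gtr genD.
by apply: eq_gen => k; rewrite !mxE.
Qed.
End GradedTrace.

(** * Matrix model of a simple highest weight module *)

Section MatrixModel.
Variables (F : numFieldType) (n : nat) (deg : 'I_n -> nat * nat) (k0 : 'I_n).
Variables (E1 E2 F1 F2 : 'M[F]_n) (a b r : nat).
Local Notation K := {poly {poly F}}.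
Local Notation x := ('X%:P : K).
Local Notation y := ('X : K).
Local Notation gen := (gen deg).
Local Notation gtr := (gtr deg).
Local Notation lowers := (lowers deg).

(** The values on h_1 and h_2 of nu - i alpha_1 - j alpha_2, where (i, j) is the degree and [a], [b]
    are the values of nu. *)
Definition wt1 (k : 'I_n) : F := a%:R - 2 * (deg k).1%:R + r%:R * (deg k).2%:R.
Definition wt2 (k : 'I_n) : F := b%:R + (deg k).1%:R - 2 * (deg k).2%:R.
Local Notation H1 := (diag_mx (\row_k wt1 k)).
Local Notation H2 := (diag_mx (\row_k wt2 k)).

(* r is - alpha_2(h_1); wm_cyclic is what generation by the top vector gives. *)
Record weight_model : Prop := {
  wm_top : forall k, (deg k == (0%N, 0%N)) = (k == k0);
  wm_E1 : lowers (1, 0)%N E1;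
  wm_E2 : lowers (0, 1)%N E2;
  wm_cm : chevalley_matrices E1 E2 F1 F2 H1 H2 (- r%:R);
  wm_cyclic : forall C : 'M[F]_n, C *m F1 = F1 *m C -> C *m F2 = F2 *m C ->
    (forall k, k != k0 -> C k k0 = 0) -> forall k, C k k = C k0 k0
}.

Hypothesis wm : weight_model.

Lemma deg_top : deg k0 = (0, 0)%N.
Proof. by apply/eqP; rewrite (wm_top wm). Qed.

(** A raising operator kills the top vector, since no degree is below (0, 0); hence [N *m M] has
    zero column [k0]. *)
Lemma anti_top d (M N : 'M[F]_n) k : lowers d M -> d != (0, 0)%N ->
  anti M N k k0 = brk M N k k0.
Proof.
move=> dM d0.
have M0 l : M l k0 = 0.
  apply/eqP; apply: contraNT d0 => /dM; rewrite deg_top.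
  by case: d dM => u v _ [/= hu hv]; rewrite xpair_eqE; lia.
by rewrite !mxE (@big1 _ 0 +%R _ _ _ (fun l => N k l * M l k0)) ?addr0 ?subr0 // => l _;
  rewrite M0 mulr0.
Qed.

Lemma gen1_top : (gen (fun=> 1 : F))`_0`_0 = 1.
Proof.
rewrite !coef_sum (bigD1 k0) //= big1 => [|k kk0].
  by rewrite !coefCM coef_mon deg_top eqxx !mulr1 addr0.
by rewrite !coefCM coef_mon eq_sym (wm_top wm) (negPf kk0) mulr0.
Qed.

Lemma mon10 : mon F (1, 0)%N = x.
Proof. by rewrite /mon /= expr0 mulr1 expr1. Qed.
Lemma mon01 : mon F (0, 1)%N = y.
Proof. by rewrite /mon /= expr0 mul1r expr1. Qed.
Lemma mon11 : mon F (1, 1)%N = x * y.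
Proof. by rewrite /mon /= !expr1. Qed.
Lemma mon21 : mon F (2, 1)%N = x * x * y.
Proof. by rewrite /mon /= expr1 expr2. Qed.

Local Notation E3 := (brk E1 E2).
Local Notation F3 := (brk F2 F1).
Local Notation E4 := (brk E1 E3).
Local Notation F4 := (brk F3 F1).

Lemma wm_E3 : lowers (1, 1)%N E3.
Proof. exact: (lowers_brk (wm_E1 wm) (wm_E2 wm)). Qed.
Lemma wm_E4 : lowers (2, 1)%N E4.
Proof. exact: (lowers_brk (wm_E1 wm) wm_E3). Qed.

Lemma anti_diag (u v : 'I_n -> F) k l :
  anti (diag_mx (\row_j u j)) (diag_mx (\row_j v j)) k l = (2 * u k * v k) *+ (k == l).
Proof.
rewrite /anti !mul_diag_mx !mxE; case: eqP => [->|_];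
  last by rewrite !mulr0n !mulr0 addr0.
by rewrite !mulr1n; ring.
Qed.

Lemma A2_model_dimension : r = 1%N -> brk F1 F3 = 0 -> brk F2 F3 = 0 ->
  (2 * n = a.+1 * b.+1 * (a.+1 + b.+1))%N.
Proof.
move=> r1 s1 s2.
have cm : chevalley_matrices E1 E2 F1 F2 H1 H2 (-1).
  by have := wm_cm wm; rewrite [X in - X%:R]r1.
have [c1 c2] := A2_casimir_central cm s1 s2.
have [e11 _ _ e22 _ _ _ _ _ _ _ _] := cm; have e33 := brk_E3F3 cm.
have [[dE1 dE2] dE3] := (wm_E1 wm, wm_E2 wm, wm_E3).
pose C := A2_casimir E1 E2 F1 F2 H1 H2.
have CE k l : C k l = 3^-1 * (anti H1 H1 k l + anti H1 H2 k l + anti H2 H2 k l)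
    + anti E1 F1 k l + anti E2 F2 k l + anti E3 F3 k l.
  rewrite /C /A2_casimir.
  move: (anti H1 H1) (anti H1 H2) (anti H2 H2) (anti E1 F1) (anti E2 F2) (anti E3 F3).
  by move=> u1 u2 u3 u4 u5 u6; rewrite !mxE.
have Ctop k : C k k0 = (3^-1 * (2 * wt1 k * wt1 k + 2 * wt1 k * wt2 k
    + 2 * wt2 k * wt2 k) + 2 * wt1 k + 2 * wt2 k) *+ (k == k0).
  rewrite CE !anti_diag (anti_top F1 k dE1) // (anti_top F2 k dE2) //.
  rewrite (anti_top F3 k dE3) // e11 e22 e33 !mxE.
  by case: eqP => _; rewrite ?mulr1n ?mulr0n; ring.
(* The scalar (nu, nu + 2 rho), read off on the top vector. *)
have CX k : C k k = 3^-1 * (2 * a%:R * a%:R + 2 * a%:R * b%:R + 2 * b%:R * b%:R)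
    + 2 * a%:R + 2 * b%:R.
  rewrite (wm_cyclic wm c1 c2) => [|j /negPf jk0]; last by rewrite Ctop jk0.
  by rewrite Ctop eqxx /wt1 /wt2 deg_top /=; ring.
pose X := gen (fun=> 1 : F).
have H1E : gen wt1 = a%:R * X - 2 * thetax X + thetay X.
  by rewrite /X !genE; apply: eq_gen => k; rewrite /wt1 r1; ring.
have H2E : gen wt2 = b%:R * X + thetax X - 2 * thetay X.
  by rewrite /X !genE; apply: eq_gen => k; rewrite /wt2; ring.
have T1 : (1 - x) * gtr (E1 *m F1) = a%:R * X - 2 * thetax X + thetay X.
  rewrite -mon10 (gtr_brk F1 dE1) e11 -H1E; apply: eq_gen => k.
  by rewrite !mxE eqxx.
have T2 : (1 - y) * gtr (E2 *m F2) = b%:R * X + thetax X - 2 * thetay X.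
  rewrite -mon01 (gtr_brk F2 dE2) e22 -H2E; apply: eq_gen => k.
  by rewrite !mxE eqxx.
have T3 : (1 - x * y) * gtr (E3 *m F3) = (a%:R + b%:R) * X - thetax X - thetay X.
  rewrite -mon11 (gtr_brk F3 dE3) e33 mulrDl [_ + _ * X]addrC -!addrA.
  transitivity (gen wt1 + gen wt2).
    by rewrite genD; apply: eq_gen => k; rewrite !mxE eqxx !mulr1n; ring.
  by rewrite H1E H2E; ring.
(* The graded trace of [C], with (nu, nu) X subtracted from both sides. *)
have HC : laplacian (@thetax F) (@thetay F) 2 (-1) 2 a%:R b%:R X
    + (1 + x) * gtr (E1 *m F1) + (1 + y) * gtr (E2 *m F2)
    + (1 + x * y) * gtr (E3 *m F3) = 2 * (a%:R + b%:R) * X.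
  rewrite -mon11 -mon10 -mon01 (gtr_anti F1 dE1) (gtr_anti F2 dE2) (gtr_anti F3 dE3).
  rewrite /laplacian mulrN1 mulNr -!natrD -!natrM /X !genE; apply: eq_gen => k.
  have := CX k; rewrite CE !anti_diag eqxx !mulr1n /wt1 /wt2 r1.
  move: (anti E1 F1 k k) (anti E2 F2 k k) (anti E3 F3 k k) => u1 u2 u3 E.
  move/eqP: E; rewrite -subr_eq0 => /eqP E.
  by apply/eqP; rewrite -subr_eq0; apply/eqP; rewrite -[RHS]E; field.
have := A2_laplacian (derivation_thetax F) (derivation_thetay F) (thetax_x F)
  (thetax_y F) (thetay_x F) (thetay_y F) T1 T2 T3 HC.
rewrite !natr1 => /(A2_dimension (ltn0Sn a) (ltn0Sn b) gen1_top).
by rewrite gen1_horner -natrM => /eqP; rewrite eqr_nat => /eqP.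
Qed.

Lemma C2_model_dimension : r = 2%N -> brk F1 F4 = 0 -> brk F2 F3 = 0 ->
  (6 * n = a.+1 * b.+1 * (a.+1 + b.+1) * (a.+1 + 2 * b.+1))%N.
Proof.
move=> r2 s1 s2.
have cm : chevalley_matrices E1 E2 F1 F2 H1 H2 (-2).
  by have := wm_cm wm; rewrite [X in - X%:R]r2.
have [c1 c2] := C2_casimir_central cm s1 s2.
have [e11 _ _ e22 _ _ _ _ _ _ _ _] := cm.
have e33 := brk_E3F3 cm; have e44 := C2_brk_E4F4 cm erefl.
have [[[dE1 dE2] dE3] dE4] := (wm_E1 wm, wm_E2 wm, wm_E3, wm_E4).
pose C := C2_casimir E1 E2 F1 F2 H1 H2.
have CE k l : C k l = 2^-1 * anti H1 H1 k l + anti H1 H2 k l + anti H2 H2 k l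
    + anti E1 F1 k l + 2 * anti E2 F2 k l + anti E3 F3 k l + 2^-1 * anti E4 F4 k l.
  rewrite /C /C2_casimir.
  move: (anti H1 H1) (anti H1 H2) (anti H2 H2) (anti E1 F1) (anti E2 F2) (anti E3 F3)
    (anti E4 F4).
  by move=> u1 u2 u3 u4 u5 u6 u7; rewrite !mxE.
have Ctop k : C k k0 = (wt1 k * wt1 k + 2 * wt1 k * wt2 k + 2 * wt2 k * wt2 k
    + 4 * wt1 k + 6 * wt2 k) *+ (k == k0).
  rewrite CE !anti_diag (anti_top F1 k dE1) // (anti_top F2 k dE2) //.
  rewrite (anti_top F3 k dE3) // (anti_top F4 k dE4) // e11 e22 e33 e44 !mxE.
  by case: eqP => _; rewrite ?mulr1n ?mulr0n; field.
have CX k : C k k = a%:R * a%:R + 2 * a%:R * b%:R + 2 * b%:R * b%:R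
    + 4 * a%:R + 6 * b%:R.
  rewrite (wm_cyclic wm c1 c2) => [|j /negPf jk0]; last by rewrite Ctop jk0.
  by rewrite Ctop eqxx /wt1 /wt2 deg_top /=; ring.
pose X := gen (fun=> 1 : F).
have H1E : gen wt1 = a%:R * X - 2 * thetax X + 2 * thetay X.
  by rewrite /X !genE; apply: eq_gen => k; rewrite /wt1 r2; ring.
have H2E : gen wt2 = b%:R * X + thetax X - 2 * thetay X.
  by rewrite /X !genE; apply: eq_gen => k; rewrite /wt2; ring.
have T1 : (1 - x) * gtr (E1 *m F1) = a%:R * X - 2 * thetax X + 2 * thetay X.
  rewrite -mon10 (gtr_brk F1 dE1) e11 -H1E; apply: eq_gen => k.
  by rewrite !mxE eqxx.
(* The long roots enter [C2_casimir] with coefficients 2 and 1/2, absorbed here and in [T]. *)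
have T2 : (1 - y) * (2 * gtr (E2 *m F2)) = 2 * b%:R * X + 2 * thetax X - 4 * thetay X.
  rewrite mulrCA -mon01 (gtr_brk F2 dE2) e22.
  rewrite [RHS](_ : _ = 2 * (b%:R * X + thetax X - 2 * thetay X)); last by ring.
  by rewrite -H2E; congr (_ * _); apply: eq_gen => k; rewrite !mxE eqxx.
have T3 : (1 - x * y) * gtr (E3 *m F3) = (a%:R + 2 * b%:R) * X - 2 * thetay X.
  rewrite -mon11 (gtr_brk F3 dE3) e33.
  transitivity (gen wt1 + 2 * gen wt2).
    by rewrite !genE; apply: eq_gen => k; rewrite !mxE eqxx !mulr1n; ring.
  by rewrite H1E H2E; ring.
pose T := (2^-1)%:P%:P * gtr (E4 *m F4).
have T4 : (1 - x * x * y) * T = (2 * a%:R + 2 * b%:R) * X - 2 * thetax X.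
  rewrite /T mulrCA -mon21 (gtr_brk F4 dE4) e44.
  transitivity (2 * gen wt1 + 2 * gen wt2); last by rewrite H1E H2E; ring.
  by rewrite !genE; apply: eq_gen => k; rewrite !mxE eqxx !mulr1n; field.
have HC : laplacian (@thetax F) (@thetay F) 2 (-2) 4 a%:R (2 * b%:R) X
    + (1 + x) * gtr (E1 *m F1) + (1 + y) * (2 * gtr (E2 *m F2))
    + (1 + x * y) * gtr (E3 *m F3) + (1 + x * x * y) * T
    = (4 * a%:R + 6 * b%:R) * X.
  rewrite /T [_ * (2 * gtr _)]mulrCA [_ * (_%:P * gtr _)]mulrCA.
  rewrite -mon21 -mon11 -mon10 -mon01.
  rewrite (gtr_anti F1 dE1) (gtr_anti F2 dE2) (gtr_anti F3 dE3) (gtr_anti F4 dE4).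
  rewrite /laplacian mulrN mulNr -!natrM -!natrD /X !genE; apply: eq_gen => k.
  have := CX k; rewrite CE !anti_diag eqxx !mulr1n /wt1 /wt2 r2.
  move: (anti E1 F1 k k) (anti E2 F2 k k) (anti E3 F3 k k) (anti E4 F4 k k) => u1 u2
    u3 u4 E.
  move/eqP: E; rewrite -subr_eq0 => /eqP E.
  by apply/eqP; rewrite -subr_eq0; apply/eqP; rewrite -[RHS]E; field.
have := C2_laplacian (derivation_thetax F) (derivation_thetay F) (thetax_x F)
  (thetax_y F) (thetay_x F) (thetay_y F) T1 T2 T3 T4 HC.
rewrite !natr1 => /(C2_dimension (ltn0Sn a) (ltn0Sn b) gen1_top).
by rewrite gen1_horner -natrM => /eqP; rewrite eqr_nat => /eqP.
Qed.
End MatrixModel.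

(** * Weight bases *)

(** Greedy extension, which stops because a free family is no longer than the dimension. Keeping
    [t0] will make the highest weight vector a basis vector. *)
Lemma free_spanning_subfamily (F : fieldType) (V : vectType F) (T : eqType)
    (u : T -> V) (t0 : T) : u t0 != 0 ->
  exists s : seq T, [/\ t0 \in s, free (map u s) & forall t, u t \in <<map u s>>%VS].
Proof.
move=> ut0.
suff grow m s : (\dim {:V} - size s <= m)%N -> t0 \in s -> free (map u s) ->
    exists s : seq T, [/\ t0 \in s, free (map u s) & forall t, u t \in <<map u s>>%VS].
  apply: (grow _ [:: t0]); rewrite ?inE ?leqnn ?eqxx //=.
  by rewrite free_cons span_nil memv0 ut0 nil_free.
elim: m s => [|m IH] s ms t0s sfree; have [spans|/existsNP[t /negP ut]] :=
  pselect (forall t, u t \in <<map u s>>%VS); try by exists s.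
- have tfree : free (map u (t :: s)) by rewrite /= free_cons ut.
  have := dimvS (subvf <<map u (t :: s)>>%VS); rewrite (eqP tfree) size_map /=; lia.
- have tfree : free (map u (t :: s)) by rewrite /= free_cons ut.
  by apply: (IH (t :: s)); rewrite ?inE ?t0s ?orbT //=; lia.
Qed.

Section WeightBasis.
Variables (F : numFieldType) (g : lieAlgType F) (V : lieModType g).

Definition act_lin (x : g) : {linear V -> V} :=
  HB.pack (lie_act x) (GRing.isLinear.Build _ _ _ _ (lie_act x)
    (@lie_act_linearr F g V x)).
Definition act_linl (v : V) : {linear g -> V} :=
  HB.pack ((@lie_act F g V)^~ v)
    (GRing.isLinear.Build _ _ _ _ ((@lie_act F g V)^~ v) (@lie_act_linearl F g V v)).

Lemma actZr (x : g) c (w : V) : lie_act x (c *: w) = c *: lie_act x w.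
Proof. exact: (linearZ_LR (act_lin x)). Qed.
Lemma act_sumr (x : g) (I : finType) (w : I -> V) :
  lie_act x (\sum_i w i) = \sum_i lie_act x (w i).
Proof. exact: (linear_sum (act_lin x)). Qed.
Lemma actZl c (x : g) (w : V) : lie_act (c *: x) w = c *: lie_act x w.
Proof. exact: (linearZ_LR (act_linl w)). Qed.
Lemma act0l (w : V) : lie_act (0 : g) w = 0.
Proof. exact: (linear0 (act_linl w)). Qed.
Lemma actNl (x : g) (w : V) : lie_act (- x) w = - lie_act x w.
Proof. exact: (linearN (act_linl w)). Qed.

Lemma stable_span (X : seq V) (x : g) :
  (forall w, w \in X -> lie_act x w \in <<X>>%VS) ->
  forall w, w \in <<X>>%VS -> lie_act x w \in <<X>>%VS.
Proof.
move=> Xx w /(@coord_span _ _ _ (in_tuple X)) ->; rewrite act_sumr.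
by apply: memv_suml => i _; rewrite actZr memvZ // Xx // mem_nth.
Qed.

(** Built as a subspace of [g] so that [chevalley_gen] applies; a basis of [U] suffices by
    linearity. *)
Definition stabilizer (U : {vspace V}) : {vspace g} :=
  (\bigcap_(i < \dim U) (linfun (act_linl (vbasis U)`_i) @^-1: U))%VS.

Lemma mem_stabilizer (U : {vspace V}) x :
  reflect (forall w, w \in U -> lie_act x w \in U) (x \in stabilizer U).
Proof.
apply: (iffP idP) => [|xU].
  rewrite memvE => /subv_bigcapP xS w wU.
  rewrite (coord_vbasis wU) act_sumr; apply: memv_suml => i _.
  rewrite actZr memvZ //; have := xS i isT.
  by rewrite -memvE -memv_preim lfunE.
rewrite memvE; apply/subv_bigcapP => i _; rewrite -memvE -memv_preim lfunE /=.
by apply/xU/vbasis_mem/mem_nth; rewrite size_tuple.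
Qed.

Lemma lie_subalgebra_stabilizer (U : {vspace V}) : lie_subalgebra (stabilizer U).
Proof.
move=> x y /mem_stabilizer xU /mem_stabilizer yU; apply/mem_stabilizer => w wU.
by rewrite lie_act_lie; apply: memvB; [apply/xU/yU | apply/yU/xU].
Qed.

Lemma chevalley_submodule A (e h f : 'I_2 -> g) (U : {vspace V}) :
  chevalley_generators A e h f ->
  (forall i w, w \in U ->
     [/\ lie_act (e i) w \in U, lie_act (h i) w \in U & lie_act (f i) w \in U]) ->
  lie_submodule U.
Proof.
move=> /chevalley_gen gen Ustable x w wU.
have : x \in stabilizer U.
  rewrite (gen _ (@lie_subalgebra_stabilizer U)) ?memvf // => i.
  by split; apply/mem_stabilizer => u /(Ustable i)[].
by move/mem_stabilizer; apply.
Qed.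
End WeightBasis.

Section RepresentationMatrix.
Variables (F : numFieldType) (g : lieAlgType F) (V : lieModType g).
Variables (n : nat) (B : n.-tuple V).
Hypothesis basisB : basis_of fullv B.

Definition rep_mx (x : g) : 'M[F]_n := \matrix_(k, l) coord B k (lie_act x B`_l).
Definition coord_cv (w : V) : 'cV[F]_n := \col_k coord B k w.

Lemma rep_mxP (x : g) (w : V) : rep_mx x *m coord_cv w = coord_cv (lie_act x w).
Proof.
apply/matrixP=> k l; rewrite !mxE [in RHS](coord_basis basisB (memvf w)).
rewrite act_sumr linear_sum; apply: eq_bigr => i _.
by rewrite !mxE actZr linearZ mulrC.
Qed.

Lemma coord_cv_basis (l : 'I_n) : coord_cv B`_l = delta_mx l 0.
Proof.
by apply/matrixP=> k z; rewrite !mxE coord_free ?(basis_free basisB) // ord1 eqxx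
  andbT eq_sym.
Qed.

Lemma rep_mx_lie (x y : g) : rep_mx (lie x y) = brk (rep_mx x) (rep_mx y).
Proof.
apply/matrixP=> k l.
have : rep_mx (lie x y) *m coord_cv B`_l = brk (rep_mx x) (rep_mx y) *m coord_cv B`_l.
  rewrite rep_mxP lie_act_lie /brk mulmxBl -!mulmxA !rep_mxP.
  by apply/matrixP=> i j; rewrite !mxE linearB.
by rewrite coord_cv_basis -!colE => /colP/(_ k); rewrite ![col _ _ k 0]mxE.
Qed.

Lemma rep_mx_scale c (x : g) : rep_mx (c *: x) = c *: rep_mx x.
Proof. by apply/matrixP=> k l; rewrite !mxE actZl linearZ. Qed.
Lemma rep_mx_opp (x : g) : rep_mx (- x) = - rep_mx x.
Proof. by apply/matrixP=> k l; rewrite !mxE actNl linearN. Qed.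
Lemma rep_mx0 : rep_mx 0 = 0.
Proof. by apply/matrixP=> k l; rewrite !mxE act0l linear0. Qed.

Lemma rep_mx_iter m (x y : g) :
  rep_mx (iter m (lie x) y) = iter m (brk (rep_mx x)) (rep_mx y).
Proof. by elim: m => //= m IH; rewrite rep_mx_lie IH. Qed.
End RepresentationMatrix.

Lemma ord2P (i : 'I_2) : i = 0 \/ i = 1.
Proof. by case: i => [[|[|//]] ilt]; [left | right]; apply: val_inj. Qed.

(** The Cartan matrix has determinant 4 - r, nonzero, so values on the coroots determine degrees. *)
Lemma weight_shift r (d d' : nat * nat) (p q : nat) : (0 < r < 4)%N ->
  (2 * d'.1 + r * d.2 + r * q = 2 * d.1 + r * d'.2 + 2 * p)%N ->
  (d.1 + 2 * d'.2 + p = d'.1 + 2 * d.2 + 2 * q)%N ->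
  d' = (d.1 + p, d.2 + q)%N.
Proof.
case: d d' => i j [i' j'] /= r12 e1 e2.
by have [] : i' = (i + p)%N /\ j' = (j + q)%N; [case: r r12 e1 => [|[|[|[|r]]]] //;
  lia | move=> -> ->].
Qed.

(** * A weight basis of monomials in the f_i applied to the highest weight vector *)

Section HighestWeight.
Variables (F : numFieldType) (g : lieAlgType F) (V : lieModType g).
Variables (A : 'M[int]_2) (e h f : 'I_2 -> g) (a b r : nat) (v : V).
Hypothesis gP : chevalley_generators A e h f.
Hypotheses (A00 : A 0 0 = 2) (A01 : A 0 1 = - r%:Z) (A10 : A 1 0 = -1).
Hypothesis A11 : A 1 1 = 2.
Hypothesis (r12 : (0 < r < 4)%N).
Hypotheses (v0 : v != 0) (ev : forall i, lie_act (e i) v = 0).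
Hypotheses (h0v : lie_act (h 0) v = a%:R *: v) (h1v : lie_act (h 1) v = b%:R *: v).
Hypothesis Vsimple : simple_lie_module V.

Definition word (s : seq 'I_2) : V := foldr (fun i => lie_act (f i)) v s.
Definition wdeg (s : seq 'I_2) : nat * nat := (count_mem 0 s, count_mem 1 s).

Lemma act_ef i j (w : V) : lie_act (e i) (lie_act (f j) w) =
  (if i == j then lie_act (h i) w else 0) + lie_act (f j) (lie_act (e i) w).
Proof.
have := lie_act_lie (e i) (f j) w; rewrite (chevalley_ef gP).
by case: eqP => _; rewrite ?act0l => ->; rewrite subrK.
Qed.

Lemma h0_word s : lie_act (h 0) (word s) =
  (a%:R - 2 * (wdeg s).1%:R + r%:R * (wdeg s).2%:R) *: word s.
Proof.
elim: s => [|i s IH]; first by rewrite /= !mulr0 subr0 addr0.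
have /= := lie_act_lie (h 0) (f i) (word s); rewrite (chevalley_hf gP) IH actZr.
move=> /eqP; rewrite eq_sym subr_eq => /eqP ->; rewrite actNl actZl -scaleNr -scalerDl.
congr (_ *: _).
by have [->|->] := ord2P i; rewrite /= ?A00 ?A01 ?mulrNz ?natrD ?natr1 -?pmulrn; ring.
Qed.

Lemma h1_word s : lie_act (h 1) (word s) =
  (b%:R + (wdeg s).1%:R - 2 * (wdeg s).2%:R) *: word s.
Proof.
elim: s => [|i s IH]; first by rewrite /= mulr0 subr0 addr0.
have /= := lie_act_lie (h 1) (f i) (word s); rewrite (chevalley_hf gP) IH actZr.
move=> /eqP; rewrite eq_sym subr_eq => /eqP ->; rewrite actNl actZl -scaleNr -scalerDl.
congr (_ *: _).
by have [->|->] := ord2P i; rewrite /= ?A10 ?A11 ?mulrNz ?natrD ?natr1 -?pmulrn; ring.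
Qed.

(** Words are weight vectors, and an e_i moves through a word until it kills [v]. The span is thus a
    nonzero submodule, and simplicity applies. *)
Lemma word_span (s : seq (seq 'I_2)) :
  (forall t, word t \in <<map word s>>%VS) -> <<map word s>>%VS = fullv.
Proof.
set U := (<<_>>)%VS => inU.
have stable x : (forall t, lie_act x (word t) \in U) ->
    forall w, w \in U -> lie_act x w \in U.
  by move=> xU; apply: stable_span => _ /mapP[t _ ->]; apply: xU.
have hU i t : lie_act (h i) (word t) \in U.
  by have [->|->] := ord2P i; rewrite ?h0_word ?h1_word memvZ.
have fU i t : lie_act (f i) (word t) \in U by apply: (inU (i :: t)).
have eU i t : lie_act (e i) (word t) \in U.
  elim: t => [|j t IH]; first by rewrite /= ev mem0v.
  rewrite /= act_ef memvD //; last by apply: (stable _ (fU j)).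
  by case: eqP => _; rewrite ?mem0v ?hU.
have [U0|//] : U = 0%VS \/ U = fullv.
- apply: Vsimple.2; apply: (chevalley_submodule gP) => i w wU.
  by split; apply: stable wU.
- by have := inU [::]; rewrite U0 memv0 (negPf v0).
Qed.

(** The basis is chosen among the words, the empty one included, and the degree counts letters. *)
Lemma weight_model_exists : exists deg k0 (E1 E2 F1 F2 : 'M[F]_(\dim {:V})),
  [/\ weight_model deg k0 E1 E2 F1 F2 a b r,
     brk F2 (brk F2 F1) = 0 & iter r.+1 (brk F1) F2 = 0].
Proof.
have [s [s0 sfree sspan]] := free_spanning_subfamily (u := word) (t0 := [::]) v0.
have sfull := word_span sspan.
have sz : size (map word s) = \dim {:V} by rewrite -sfull (eqP sfree).
pose B : (\dim {:V}).-tuple V := Tuple (introT eqP sz).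
have basisB : basis_of fullv B by rewrite /basis_of sfull eqxx.
have szs : size s = \dim {:V} by rewrite -sz size_map.
pose t (k : 'I_(\dim {:V})) := nth [::] s k.
have BE (k : 'I_(\dim {:V})) : B`_k = word (t k) by rewrite (nth_map [::]) // szs.
have s_uniq : uniq s by apply: (map_uniq (f := word)); exact: free_uniq.
have k0lt : (index [::] s < \dim {:V})%N by rewrite -szs index_mem.
pose k0 := Ordinal k0lt.
have tk0 : t k0 = [::] by rewrite /t /= nth_index.
have topP k : (wdeg (t k) == (0%N, 0%N)) = (k == k0).
  apply/eqP/eqP => [|->]; last by rewrite tk0.
  have kE : index (t k) s = k by rewrite index_uniq ?szs.
  move=> tk; apply/val_inj => /=; rewrite -kE; congr (index _ _).
  case: (t k) tk => // i u [].
  by have [->|->] := ord2P i.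
pose deg k := wdeg (t k); pose M := rep_mx B.
have H1E : M (h 0) = diag_mx (\row_k wt1 F deg a r k).
  apply/matrixP=> k l; rewrite !mxE BE h0_word -BE linearZ /= coord_free
    ?(basis_free basisB) //.
  by have [->|_] := eqVneq k l; rewrite ?mulr0 ?mulr1.
have H2E : M (h 1) = diag_mx (\row_k wt2 F deg b k).
  apply/matrixP=> k l; rewrite !mxE BE h1_word -BE linearZ /= coord_free
    ?(basis_free basisB) //.
  by have [->|_] := eqVneq k l; rewrite ?mulr0 ?mulr1.
have lieM x y : brk (M x) (M y) = M (lie x y) by rewrite -rep_mx_lie.
have MZ c x : M (c *: x) = c *: M x := rep_mx_scale B c x.
have MN x : M (- x) = - M x := rep_mx_opp B x.
have M0 : M 0 = 0 := rep_mx0 B.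
have cm : chevalley_matrices (M (e 0)) (M (e 1)) (M (f 0)) (M (f 1))
    (M (h 0)) (M (h 1)) (- r%:R).
  by split; rewrite lieM ?(chevalley_ef gP) ?(chevalley_he gP) ?(chevalley_hf gP) /=
    ?M0 //;
    rewrite ?MN ?MZ ?A00 ?A01 ?A10 ?A11 ?mulrNz ?mulr1z ?scaleN1r ?scaleNr ?opprK.
have brk_diag (d : 'I_(\dim {:V}) -> F) (N : 'M[F]_(\dim {:V})) k l :
    brk (diag_mx (\row_j d j)) N k l = (d k - d l) * N k l.
  by rewrite /brk mul_diag_mx mul_mx_diag !mxE; ring.
(* A nonzero entry of an eigenvector for the brackets with h_1 and h_2 fixes the difference of two
   weights. *)
have lowersE (N : 'M[F]_(\dim {:V})) (u w : F) :
    brk (M (h 0)) N = u *: N -> brk (M (h 1)) N = w *: N ->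
    forall k l, N k l != 0 ->
      wt1 F deg a r k - wt1 F deg a r l = u /\ wt2 F deg b k - wt2 F deg b l = w.
  rewrite H1E H2E => /matrixP Nu /matrixP Nw k l Nkl.
  by have := Nu k l; have := Nw k l; rewrite !brk_diag !mxE;
    split; apply: (mulIf Nkl).
exists deg, k0, (M (e 0)), (M (e 1)), (M (f 0)), (M (f 1)); split.
- split=> //.
  + move=> k l Ekl.
    have [|] := lowersE _ 2 (-1) (cm_H1E1 cm) _ _ _ Ekl.
      by rewrite scaleN1r (cm_H2E1 cm).
    rewrite /wt1 /wt2 => w1 w2; apply: (weight_shift r12 (p := 1) (q := 0)); apply/eqP.
    * by rewrite -(eqr_nat F) !natrD !natrM -subr_eq0
        -[X in _ == X](subrr 2) -{1}w1; apply/eqP; ring.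
    * by rewrite -(eqr_nat F) !natrD !natrM -subr_eq0
        -[X in _ == X](subrr (-1)) -{1}w2; apply/eqP; ring.
  + move=> k l Ekl.
    have [] := lowersE _ (- r%:R) 2 (cm_H1E2 cm) (cm_H2E2 cm) _ _ Ekl.
    rewrite /wt1 /wt2 => w1 w2; apply: (weight_shift r12 (p := 0) (q := 1)); apply/eqP.
    * by rewrite -(eqr_nat F) !natrD !natrM -subr_eq0
        -[X in _ == X](subrr (- r%:R)) -{1}w1; apply/eqP; ring.
    * by rewrite -(eqr_nat F) !natrD !natrM -subr_eq0
        -[X in _ == X](subrr 2) -{1}w2; apply/eqP; ring.
  + by rewrite -H1E -H2E.
  + move=> C C1 C2 Ctop k.
    have cM x w : C *m M x = M x *m C -> C *m coord_cv B w = C k0 k0 *: coord_cv B w ->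
        C *m coord_cv B (lie_act x w) = C k0 k0 *: coord_cv B (lie_act x w).
      by move=> Cx Cw; rewrite -!rep_mxP // mulmxA Cx -mulmxA Cw -scalemxAr.
    (* [C] commutes with the f_i, so its eigenvalue on [v] passes to every word. *)
    have Cword u : C *m coord_cv B (word u) = C k0 k0 *: coord_cv B (word u).
      elim: u => [|i u IH]; last by apply: cM IH; have [->|->] := ord2P i.
      rewrite -[[::]]tk0 -BE coord_cv_basis // -colE; apply/colP => j.
      rewrite !mxE eqxx andbT; have [->|/Ctop ->] := eqVneq j k0; first by rewrite mulr1.
      by rewrite mulr0.
    have := Cword (t k); rewrite -BE coord_cv_basis // -colE => /colP/(_ k).
    by rewrite !mxE !eqxx mulr1.
- have := chevalley_serre_f gP (i := 1) (j := 0) isT.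
  by rewrite A10 /= !lieM => ->.
- have := chevalley_serre_f gP (i := 0) (j := 1) isT.
  by rewrite -rep_mx_iter // A01 opprK -PoszD => ->.
Qed.
End HighestWeight.

(** * Comparison of dimensions *)

Section Poset.
Local Open Scope nat_scope.

Lemma bigminn_le (I : eqType) (r : seq I) (P : pred I) (G : I -> nat)
    (x : nat) (i : I) :
  i \in r -> P i -> \big[minn/x]_(j <- r | P j) G j <= G i.
Proof.
elim: r => // j r IH; rewrite inE big_cons => /predU1P[<- ->|ir Pi];
  first exact: geq_minl.
by case: (P j); rewrite ?geq_min IH ?orbT.
Qed.

Lemma rmin1E (i j : 'I_2) (lam : 'I_2 -> Pplus) :
  rmin i j 1 lam = minn (interval_sum i j (lam 0%R)) (interval_sum i j (lam 1%R)).
Proof.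
have isum1 s :
    interval_sum i j (\sum_(u in [set s]) lam u)%R = interval_sum i j (lam s).
  by rewrite big_set1.
apply/eqP; rewrite eqn_leq; apply/andP; split.
  by rewrite leq_min -!isum1 !bigminn_le ?mem_index_enum ?cards1.
rewrite /rmin; apply: (big_rec (fun m => minn _ _ <= m)) => [|S m /cards1P[s ->] le_m].
  (* The initial value of the minimum sums over both indices, so it dominates the term of index
     0. *)
  rewrite geq_min; apply/orP; left; apply: leq_sum => t _.
  by rewrite big_ord_recl mxE leq_addr.
by rewrite leq_min le_m andbT isum1 geq_min; have [->|->] := ord2P s;
  rewrite leqnn ?orbT.
Qed.

Lemma interval_sum_same (i : 'I_2) (nu : Pplus) : interval_sum i i nu = nu 0%R i.
Proof.
rewrite /interval_sum (big_pred1 i) // => t.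
by rewrite -eqn_leq eq_sym.
Qed.

Lemma interval_sum01 (nu : Pplus) : interval_sum 0%R 1%R nu = nu 0%R 0%R + nu 0%R 1%R.
Proof.
by rewrite /interval_sum big_mkcond /= big_ord_recl big_ord1 /=; congr (_ + nu _ _);
  apply: val_inj.
Qed.

Variables (lam mu : 'I_2 -> Pplus).
Hypotheses (same_sum : (lam 0 + lam 1 = mu 0 + mu 1)%R).
Hypothesis lam_le_mu : trianglelefteq lam mu.

(** The order at l = 1 compares minima, and the sums agree; [d] allows for the shift by rho. *)
Lemma trianglelefteq_mul (i j : 'I_2) (d : nat) : i <= j ->
  (interval_sum i j (lam 0%R) + d) * (interval_sum i j (lam 1%R) + d)
    <= (interval_sum i j (mu 0%R) + d) * (interval_sum i j (mu 1%R) + d).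
Proof.
move=> ij; apply: mul_le_of_minn_le.
  suff : interval_sum i j (lam 0%R) + interval_sum i j (lam 1%R) =
      interval_sum i j (mu 0%R) + interval_sum i j (mu 1%R) by lia.
  rewrite /interval_sum -!big_split; apply: eq_bigr => t _.
  by have /rowP/(_ t) := same_sum; rewrite !mxE.
by have := lam_le_mu ij (isT : 1 <= 1 <= 2); rewrite !rmin1E; lia.
Qed.
End Poset.

(** In the application [R] is (p_1 + 2 q_1) (p_2 + 2 q_2) = 2 S + 2 Q - P, written without truncated
    subtraction. *)
Lemma C2_mul_le (P Q S R P' Q' S' R' : nat) :
  (P <= P' -> Q <= Q' -> S <= S' -> P' <= S' -> R + P = 2 * S + 2 * Q ->
  R' + P' = 2 * S' + 2 * Q' -> P * Q * S * R <= P' * Q' * S' * R')%N.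
Proof.
move=> leP leQ leS leP' RE RE'.
have lePR : (P * R <= P' * R')%N.
  (* With P' = P + d and R' = P + k one gets R <= P' + k, and P' R' - P (P' + k) = d k. *)
  have [d dE] : exists d, P' = (P + d)%N by exists (P' - P)%N; lia.
  have [k kE] : exists k, (2 * S' + 2 * Q' = P + P' + k)%N.
    by exists (2 * S' + 2 * Q' - (P + P'))%N; lia.
  have leR : (P * R <= P * (P' + k))%N by rewrite leq_mul2l; lia.
  have -> : R' = (P + k)%N by lia.
  rewrite dE in leR *; nia.
have assoc p q s u : (p * q * s * u = (p * u) * (q * s))%N.
  by lia.
by rewrite (assoc P) (assoc P'); apply: leq_mul => //; apply: leq_mul.
Qed.

(** * Dimensions of the simple modules V(nu) *)

Section Dimension.
Variables (F : numFieldType) (X : rank2_type) (g : lieAlgType F) (e h f : 'I_2 -> g).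
Hypothesis gP : chevalley_generators (cartan_matrix X) e h f.
Variables (nu : Pplus) (V : lieModType g).
Hypothesis VP : is_simple_highest_weight e h (iota_weight F nu) V.

Lemma iota_weightE i : iota_weight F nu 0 i = (nu 0 i)%:R.
Proof.
rewrite /iota_weight summxE (bigD1 i) //= big1 => [|k ki];
  rewrite !mxE ?eqxx ?mulr1 ?addr0 //.
by rewrite (negPf ki) mulr0.
Qed.

Lemma simple_dimension :
  let p := (nu 0%R 0%R).+1 in let q := (nu 0%R 1%R).+1 in
  match X with
  | A2 => (2 * \dim {:V} = p * q * (p + q))%N
  | C2 => (6 * \dim {:V} = p * q * (p + q) * (p + 2 * q))%N
  end.
Proof.
have [Vsimple [v [v0 ev hv]]] := VP.
have h0v := hv 0; have h1v := hv 1; rewrite !iota_weightE in h0v h1v.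
have := gP; case: X => cgP p q.
- have [||||//|deg [k0 [E1 [E2 [F1 [F2 [wm s2 s1]]]]]]] :=
    weight_model_exists (r := 1) cgP _ _ _ _ _ v0 ev h0v h1v Vsimple; try by rewrite mxE.
  apply: (A2_model_dimension wm) => //; move: s1; rewrite /= [brk F1 F2]brkC brkN.
  by move/eqP; rewrite oppr_eq0 => /eqP.
- have [||||//|deg [k0 [E1 [E2 [F1 [F2 [wm s2 s1]]]]]]] :=
    weight_model_exists (r := 2) cgP _ _ _ _ _ v0 ev h0v h1v Vsimple; try by rewrite mxE.
  apply: (C2_model_dimension wm) => //; move: s1.
  by rewrite /= [brk F1 F2]brkC brkN (brkC (brk _ F1)) => <-.
Qed.
End Dimension.

Local Open Scope complex_scope.

Theorem theorem5p2 (R : realType) (X : rank2_type)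
    (g : lieAlgType R[i]) (e h f : 'I_2 -> g)
    (g_simple : simple_lie_algebra g)
    (g_type : chevalley_generators (cartan_matrix X) e h f)
    (lambda : Pplus) (lam mu : 'I_2 -> Pplus)
    (lam_in : in_Pplus2 lambda lam) (mu_in : in_Pplus2 lambda mu)
    (lam_le_mu : trianglelefteq lam mu)
    (V1 V2 W1 W2 : lieModType g)
    (V1P : is_simple_highest_weight e h (iota_weight R[i] (lam 0)) V1)
    (V2P : is_simple_highest_weight e h (iota_weight R[i] (lam 1)) V2)
    (W1P : is_simple_highest_weight e h (iota_weight R[i] (mu 0)) W1)
    (W2P : is_simple_highest_weight e h (iota_weight R[i] (mu 1)) W2) :
  (\dim {: tensor V1 V2} <= \dim {: tensor W1 W2})%N.
Proof.
rewrite dimvf dim_matrix [leqRHS]dimvf dim_matrix.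
have same : lam 0 + lam 1 = mu 0 + mu 1 by rewrite lam_in mu_in.
(* The shifts 1, 1 and 2 are the values of rho on h_1, h_2 and h_1 + h_2. *)
have leP := trianglelefteq_mul (i := 0) (j := 0) same lam_le_mu 1 isT.
have leQ := trianglelefteq_mul (i := 1) (j := 1) same lam_le_mu 1 isT.
have leS := trianglelefteq_mul (i := 0) (j := 1) same lam_le_mu 2 isT.
rewrite !interval_sum_same in leP leQ; rewrite !interval_sum01 in leS.
have := simple_dimension g_type V1P; have := simple_dimension g_type V2P.
have := simple_dimension g_type W1P; have := simple_dimension g_type W2P.
move: (\dim {:V1}) (\dim {:V2}) (\dim {:W1}) (\dim {:W2}) => v1 v2 w1 w2.
move: (lam 0 0 0) (lam 0 0 1) (lam 1 0 0) (lam 1 0 1) leP leQ leS => a1 b1 a2 b2.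
move: (mu 0 0 0) (mu 0 0 1) (mu 1 0 0) (mu 1 0 1) => c1 d1 c2 d2.
rewrite !addn1; have addSS a b : (a + b + 2 = a.+1 + b.+1)%N by lia.
rewrite !addSS => {addSS}.
move: a1.+1 a2.+1 b1.+1 b2.+1 c1.+1 c2.+1 d1.+1 d2.+1.
move=> {}a1 {}a2 {}b1 {}b2 {}c1 {}c2 {}d1 {}d2 leP leQ leS.
case: (X) => /= w2E w1E v2E v1E.
(* The factor 4, and 36 in type C2, clears the denominators 2 and 6 of two dimension formulas. *)
- rewrite -(leq_pmul2l (isT : 0 < 4)%N).
  rewrite (_ : 4 * (v1 * v2) = a1 * a2 * (b1 * b2) * ((a1 + b1) * (a2 + b2)))%N;
    last first.
    by transitivity (2 * v1 * (2 * v2))%N; [lia | rewrite v1E v2E; lia].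
  rewrite (_ : 4 * (w1 * w2) = c1 * c2 * (d1 * d2) * ((c1 + d1) * (c2 + d2)))%N;
    last first.
    by transitivity (2 * w1 * (2 * w2))%N; [lia | rewrite w1E w2E; lia].
  by apply: leq_mul leS; apply: leq_mul.
- rewrite -(leq_pmul2l (isT : 0 < 36)%N).
  rewrite (_ : 36 * (v1 * v2) = a1 * a2 * (b1 * b2) * ((a1 + b1) * (a2 + b2))
      * ((a1 + 2 * b1) * (a2 + 2 * b2)))%N; last first.
    by transitivity (6 * v1 * (6 * v2))%N; [lia | rewrite v1E v2E; lia].
  rewrite (_ : 36 * (w1 * w2) = c1 * c2 * (d1 * d2) * ((c1 + d1) * (c2 + d2))
      * ((c1 + 2 * d1) * (c2 + 2 * d2)))%N; last first.
    by transitivity (6 * w1 * (6 * w2))%N; [lia | rewrite w1E w2E; lia].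
  by apply: C2_mul_le leP leQ leS _ _ _; lia.
Qed.
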